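(* Let $D$ be the closed unit disk with $\omega=dx\wedge dy$, $o=(0,0)$, and $G_o=\{g\in\mathrm{Symp}(D)\mid g(o)=o\}$. Then $\overline{\tau}-\pi\overline{\sigma}:G_o\to\mathbb{R}$ is a continuous surjective homomorphism.
   Context: $\mathrm{Symp}(D)$ is the group of all symplectomorphisms of $D$ (not necessarily the identity on $\partial D$), with the $C^\infty$-topology. For a $1$-form $\eta$ with $d\eta=\omega$, $\tau_\eta(g)=\int_D g^*\eta\wedge\eta$ is a quasi-morphism on $\mathrm{Symp}(D)$; $\overline{\tau}$ denotes its homogenization $\overline{\tau}(g)=\lim_n\tau_\eta(g^n)/n$ (independent of $\eta$), restricted to $G_o$. For a path $\gamma$ from $o$ to a point of $\partial D$, $\sigma_{\eta,\gamma}(g)=\int_\gamma g^*\eta-\eta$ is a quasi-morphism on $G_o$; $\overline{\sigma}$ denotes its homogenization (independent of $\eta,\gamma$). *)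

(* Defs.v *)
From HB Require Import structures.
From mathcomp Require Import all_boot all_order all_algebra.
From mathcomp Require Import all_classical all_reals all_analysis.
Set Implicit Arguments. Unset Strict Implicit. Unset Printing Implicit Defensive.
Import Order.TTheory GRing.Theory Num.Theory.
Import numFieldNormedType.Exports.
Local Open Scope classical_set_scope.
Local Open Scope ring_scope.

Section Disk.
Variable R : realType.

Definition disk : set (R * R) := [set p | p.1 ^+ 2 + p.2 ^+ 2 <= 1].
Definition origin : R * R := (0, 0).

Definition dir (b : bool) : R * R := if b then (1, 0) else (0, 1).

Fixpoint pd (w : seq bool) (f : R * R -> R) : R * R -> R :=
  match w with
  | [::] => f
  | b :: w' => fun x => 'D_(dir b) (pd w' f) x
  end.

Definition dx (f : R * R -> R) := pd [:: true] f.
Definition dy (f : R * R -> R) := pd [:: false] f.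

Definition smooth_on (U : set (R * R)) (f : R * R -> R) : Prop :=
  open U /\ forall (w : seq bool) (x : R * R), U x ->
    [/\ derivable (pd w f) x (dir true), derivable (pd w f) x (dir false)
      & {for x, continuous (pd w f)}].

Definition smooth_map_on_disk (g : R * R -> R * R) : Prop :=
  exists U : set (R * R), disk `<=` U /\
    smooth_on U (fun p => (g p).1) /\ smooth_on U (fun p => (g p).2).

(** Jacobian determinant, i.e. g^* (dx /\ dy) = jac g dx /\ dy. *)
Definition jac (g : R * R -> R * R) (p : R * R) : R :=
  dx (fun q => (g q).1) p * dy (fun q => (g q).2) p
  - dy (fun q => (g q).1) p * dx (fun q => (g q).2) p.

(** Symp(D): diffeomorphisms of D (smooth with smooth inverse, up to the
    boundary) preserving omega = dx /\ dy. Maps are represented by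
    functions R^2 -> R^2; only their values on D matter. *)
Definition symp (g : R * R -> R * R) : Prop :=
  [/\ smooth_map_on_disk g,
      (forall p, disk p -> disk (g p)),
      (exists h : R * R -> R * R,
          [/\ smooth_map_on_disk h, (forall p, disk p -> disk (h p)),
              (forall p, disk p -> h (g p) = p) &
              (forall p, disk p -> g (h p) = p)]) &
      (forall p, disk p -> jac g p = 1)].

Definition G_o (g : R * R -> R * R) : Prop := symp g /\ g origin = origin.

(** The primitive eta = (x dy - y dx)/2 of omega, eta = a dx + b dy. *)
Definition eta_a (p : R * R) : R := - p.2 / 2.
Definition eta_b (p : R * R) : R := p.1 / 2.

(** g^* eta = P dx + Q dy. *)
Definition pullP (g : R * R -> R * R) (p : R * R) : R :=
  eta_a (g p) * dx (fun q => (g q).1) p + eta_b (g p) * dx (fun q => (g q).2) p.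
Definition pullQ (g : R * R -> R * R) (p : R * R) : R :=
  eta_a (g p) * dy (fun q => (g q).1) p + eta_b (g p) * dy (fun q => (g q).2) p.

(** tau_eta(g) = int_D g^* eta /\ eta ; (P dx + Q dy) /\ (a dx + b dy) = (P b - Q a) dx/\dy. *)
Definition tau (g : R * R -> R * R) : R :=
  Rintegral ((@lebesgue_measure R) \x (@lebesgue_measure R))%E disk
    (fun p => pullP g p * eta_b p - pullQ g p * eta_a p).

(** sigma_{eta,gamma}(g) = int_gamma (g^* eta - eta), gamma(t) = (t, 0), t in [0,1]. *)
Definition sigma (g : R * R -> R * R) : R :=
  Rintegral (@lebesgue_measure R) `[0, 1]
    (fun t => pullP g (t, 0) - eta_a (t, 0)).

Definition homogenize (phi : (R * R -> R * R) -> R) (g : R * R -> R * R) : R :=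
  limn (fun n : nat => phi (iter n g) / n%:R).

Definition tau_bar := homogenize tau.
Definition sigma_bar := homogenize sigma.

Definition Cinf_continuous_on_G_o (phi : (R * R -> R * R) -> R) : Prop :=
  forall g, G_o g -> forall e : R, 0 < e ->
    exists (k : nat) (d : R), 0 < d /\
      forall h, G_o h ->
        (forall w : seq bool, (size w <= k)%N -> forall p, disk p ->
           `| pd w (fun q => (h q).1) p - pd w (fun q => (g q).1) p | < d /\
           `| pd w (fun q => (h q).2) p - pd w (fun q => (g q).2) p | < d) ->
        `| phi h - phi g | < e.

End Disk.

(* Main.v *)
(* Write eta = (x dy - y dx)/2 and let g be in G_o. Since g preserves omega,
   g^*eta - eta is closed on D, hence equals dF_g with F_g(o) = 0. Then
   sigma(g) = F_g(1,0), while Green's formula for d(F_g eta) gives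
     tau(g) = 1/2 int_0^{2 pi} F_g(cos t, sin t) dt - int_D F_g omega.
   As g restricts to an injective map of the circle, F_g oscillates there by at
   most 2 pi, whatever g is, so tau(g^n) - pi sigma(g^n) + int_D F_{g^n} omega
   is bounded. Moreover F_{gh} = F_h + F_g o h and h preserves area, so
   int_D F_g omega is additive in g; hence bar tau - pi bar sigma is exactly
   g |-> - int_D F_g omega, a homomorphism, continuous already for the C^1
   topology. Area preservation, int_D f o h = int_D f, again reduces to the
   boundary: f omega = d(2 m eta) where m(p) = int_0^1 t f(tp) dt, and h induces
   a degree one map of the circle. Surjectivity comes from the twists rotating p
   by the angle c |p|^2, for which F = c |p|^4 / 4. *)
Require Import Defs.
From HB Require Import structures.
From mathcomp Require Import all_boot all_order all_algebra.
From mathcomp Require Import all_classical all_reals all_analysis.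
From mathcomp Require Import ring lra.
Import Order.TTheory GRing.Theory Num.Theory.
Import numFieldNormedType.Exports.
Local Open Scope classical_set_scope.
Local Open Scope ring_scope.
Set Implicit Arguments. Unset Strict Implicit. Unset Printing Implicit Defensive.

(** * Differential calculus in the plane *)

Section Calculus1.
Context {R : realType}.
Implicit Types (f df : R -> R) (x y : R).

(** Maps are total functions on the plane, smooth only near [disk], and [jac] is known to be 1 only
    on [disk]. Regularity is therefore kept on a slightly larger ball, open and star-shaped, while
    every formula for the partials of [gen] is confined to [disk]. An integral over the circle is
    recorded as the increment over [0, 2 pi] of any function with the right derivative, so that
    reparametrizing by an angular lift amounts to the chain rule. The degree of the lift is read off
    from areas: Green's formula for g^*eta makes its total increment twice the area of the disk, for
    [g] and for the identity alike. Homogenizations are limits that must first be shown to exist: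
    the oscillation bound for F_g on the circle, combined with F_{gh} = F_h + F_g o h, also bounds
    the defect of sigma along iterates, so sigma(g^n)/n converges, and tau(g^n)/n inherits
    convergence from the comparison. *)

Lemma MVT_between f df x y :
  (forall s, Num.min x y <= s <= Num.max x y -> is_derive s 1 f (df s)) ->
  exists2 c, Num.min x y <= c <= Num.max x y & f y - f x = df c * (y - x).
Proof.
move=> fdf; have key (a b : R) : a <= b ->
    (forall s, a <= s <= b -> is_derive s 1 f (df s)) ->
    exists2 c, a <= c <= b & f b - f a = df c * (b - a).
  move=> ab fab; have fab' s : s \in `]a, b[ -> is_derive s 1 f (df s).
    by rewrite in_itv/= => /andP[/ltW as_ /ltW sb]; apply: fab; rewrite as_ sb.
  have [|c cab fE] := MVT_segment ab fab'.
    apply: derivable_within_continuous => s; rewrite in_itv/= => sab.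
    by have [] := fab _ sab.
  by exists c => //; move: cab; rewrite in_itv.
move: fdf; case: (leP x y) => [xy|/ltW yx] fdf; first exact: key.
have [c cyx fE] := key _ _ yx fdf.
by exists c => //; rewrite -opprB fE -mulrN opprB.
Qed.

(** This form of the mean value theorem, with a reference slope [a], serves total differentiability,
    differentiation under the integral and the comparison of [tau] with [sigma]. *)
Lemma MVT_dist f df a e x y :
  (forall s, Num.min x y <= s <= Num.max x y ->
     is_derive s 1 f (df s) /\ `|df s - a| <= e) ->
  `|f y - f x - a * (y - x)| <= e * `|y - x|.
Proof.
move=> fdf; have [c cxy ->] := @MVT_between f df x y (fun s h => (fdf s h).1).
by rewrite -mulrBl normrM ler_wpM2r// (fdf _ cxy).2.
Qed.

Lemma is_derive0_eq f x y : (forall s, Num.min x y <= s <= Num.max x y ->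
  is_derive s 1 f 0) -> f x = f y.
Proof.
move=> f0; have [c _ ] := @MVT_between f (fun=> 0) x y f0.
by rewrite mul0r => /subr0_eq.
Qed.

Lemma eq_is_derive f x (a b : R) : is_derive x 1 f a -> a = b -> is_derive x 1 f b.
Proof. by move=> ? <-. Qed.

End Calculus1.

Section Plane.
Context {R : realType}.
Notation plane := (R * R)%type.
Implicit Types (f g : plane -> R) (p q v : plane) (h : plane -> plane).

Lemma norm_fst_le v : `|v.1| <= `|v|.
Proof. by rewrite prod_normE le_max lexx. Qed.

Lemma norm_snd_le v : `|v.2| <= `|v|.
Proof. by rewrite prod_normE le_max lexx orbT. Qed.

Definition lin2 (a b : R) v : R := v.1 * a + v.2 * b.

Fact lin2_is_linear a b : linear (lin2 a b).
Proof. by move=> k u v; rewrite /lin2/= /GRing.scale/=; ring. Qed.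

HB.instance Definition _ a b :=
  GRing.isLinear.Build R (R * R)%type R _ (lin2 a b) (lin2_is_linear a b).

Lemma continuous_fst : continuous (fst : plane -> R).
Proof. by move=> p; apply: cvg_fst. Qed.

Lemma continuous_snd : continuous (snd : plane -> R).
Proof. by move=> p; apply: cvg_snd. Qed.

Lemma lin2_continuous a b : continuous (lin2 a b).
Proof.
move=> p; rewrite /continuous_at /lin2; apply: cvgD; apply: cvgM;
  [exact: cvg_fst|exact: cvg_cst|exact: cvg_snd|exact: cvg_cst].
Qed.

(** [dx] and [dy] are directional derivatives, which may exist without total differentiability and
    then obey no chain rule. Packing the differential with explicit coefficients lets partials be
    computed by rules instead of limits. *)
Definition PD f p (a b : R) := differentiable f p /\ 'd f p = lin2 a b :> (_ -> _).

Lemma PD_littleo f p a b :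
  (forall e : R, 0 < e -> \forall v \near (0 : plane),
    `|f (v + p) - f p - lin2 a b v| <= e * `|v|) -> PD f p a b.
Proof.
move=> fo. have E : f \o shift p = cst (f p) + lin2 a b +o_ (0 : plane) id.
  apply/eqaddoP => e e0; have := fo e e0.
  by apply: filterS => v; rewrite /= !fctE; congr (`|_| <= _); ring.
have D : 'd f p = lin2 a b :> (_ -> _).
  exact: (@diff_unique _ _ _ f (lin2 a b) p (@lin2_continuous a b) E).
by split => //; apply/diff_locallyP; rewrite D; split => //; exact: lin2_continuous.
Qed.

Lemma PD_dx f p a b : PD f p a b -> dx f p = a.
Proof.
move=> [df D]; rewrite /dx/= /dir deriveE// D /lin2/=; ring.
Qed.

Lemma PD_dy f p a b : PD f p a b -> dy f p = b.
Proof.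
move=> [df D]; rewrite /dy/= /dir deriveE// D /lin2/=; ring.
Qed.

Lemma differentiable_PD f p : differentiable f p -> PD f p (dx f p) (dy f p).
Proof.
move=> df; split => //; apply/funext => v.
rewrite /dx /dy/= /dir !deriveE// /lin2 -!linearZ/= -linearD.
congr ('d f p _); case: v => a b.
by rewrite -[RHS]/(a * 1 + b * 0, a * 0 + b * 1); congr pair; ring.
Qed.

Lemma near_shift0 (P : plane -> Prop) p :
  (\forall q \near p, P q) -> \forall v \near (0 : plane), P (v + p).
Proof.
move=> Pp; have : (fun v : plane => v + p) @ (0 : plane) --> p.
  by rewrite -{2}(add0r p); apply: cvgD; [exact: cvg_id|exact: cvg_cst].
by move/(_ _ Pp).
Qed.

Lemma PD_near_eq f g p a b :
  (\forall q \near p, f q = g q) -> PD f p a b -> PD g p a b.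
Proof.
move=> fg [df D]; apply: PD_littleo => e e0.
have /diff_locally := df; rewrite D => /eqaddoP /(_ e e0) fo.
have fgp := nbhs_singleton fg.
apply: filterS2 (near_shift0 fg) fo => v E; rewrite -fgp -E.
rewrite !fctE; apply: le_trans.
rewrite le_eqVlt; apply/orP; left; apply/eqP; congr (`|_|); ring.
Qed.

Lemma PD_cst (c : R) p : PD (fun=> c) p 0 0.
Proof.
apply: PD_littleo => e e0; apply: (@nearW _ (nbhs (0 : plane))) => v.
by rewrite subrr /lin2 !mulr0 addr0 subr0 normr0 mulr_ge0// ltW.
Qed.

Lemma PD_fst p : PD fst p 1 0.
Proof.
apply: PD_littleo => e e0; apply: (@nearW _ (nbhs (0 : plane))) => v.
rewrite /lin2/= [X in `|X|](_ : _ = 0) ?normr0 ?mulr_ge0 ?(ltW e0)//; ring.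
Qed.

Lemma PD_snd p : PD snd p 0 1.
Proof.
apply: PD_littleo => e e0; apply: (@nearW _ (nbhs (0 : plane))) => v.
rewrite /lin2/= [X in `|X|](_ : _ = 0) ?normr0 ?mulr_ge0 ?(ltW e0)//; ring.
Qed.

Lemma PD_D f g p a b c d : PD f p a b -> PD g p c d ->
  PD (fun q => f q + g q) p (a + c) (b + d).
Proof.
move=> [df fE] [dg gE].
have If : is_diff p f (lin2 a b) by split.
have Ig : is_diff p g (lin2 c d) by split.
have [dS SE] : is_diff p (f + g) (lin2 a b + lin2 c d : plane -> R).
  exact: is_diffD.
split; first exact: dS.
apply: etrans SE _; apply/funext => v.
by rewrite -[LHS]/(lin2 a b v + lin2 c d v) /lin2; ring.
Qed.

Lemma PD_M f g p a b c d : PD f p a b -> PD g p c d ->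
  PD (fun q => f q * g q) p (a * g p + f p * c) (b * g p + f p * d).
Proof.
move=> [df fE] [dg gE].
have If : is_diff p f (lin2 a b) by split.
have Ig : is_diff p g (lin2 c d) by split.
have [dM ME] : is_diff p (f * g) (f p *: lin2 c d + g p *: lin2 a b : plane -> R).
  exact: is_diffM.
split; first exact: dM.
apply: etrans ME _; apply/funext => v.
by rewrite -[LHS]/(f p * lin2 c d v + g p * lin2 a b v) /lin2/=; ring.
Qed.

Lemma PD_eq f p a b c d : PD f p a b -> a = c -> b = d -> PD f p c d.
Proof. by move=> ? <- <-. Qed.

Lemma PD_N f p a b : PD f p a b -> PD (fun q => - f q) p (- a) (- b).
Proof.
move=> fab; have -> : (fun q => - f q) = (fun q => -1 * f q).
  by apply/funext => q; rewrite mulN1r.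
by apply: PD_eq (PD_M (PD_cst (-1) p) fab) _ _; ring.
Qed.

Lemma PD_Z f p k a b : PD f p a b -> PD (fun q => k * f q) p (k * a) (k * b).
Proof. by move=> fab; apply: PD_eq (PD_M (PD_cst k p) fab) _ _; ring. Qed.

Lemma PD_comp f h p a b a1 b1 a2 b2 : PD f (h p) a b ->
  PD (fun q => (h q).1) p a1 b1 -> PD (fun q => (h q).2) p a2 b2 ->
  PD (fun q => f (h q)) p (a * a1 + b * a2) (a * b1 + b * b2).
Proof.
move=> [df fE] [d1 E1] [d2 E2].
have hE : h = (fun q => ((h q).1, (h q).2)) by apply/funext => q; case: (h q).
have dh : differentiable h p by rewrite hE; exact: differentiable_pair.
have hD : 'd h p = (fun v => (lin2 a1 b1 v, lin2 a2 b2 v)) :> (_ -> _).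
  by rewrite {1}hE diff_pair// E1 E2.
split; first exact: differentiable_comp.
rewrite (diff_comp dh df) fE hD; apply/funext => v /=.
by rewrite /lin2/=; ring.
Qed.

Lemma PD_curve f (c1 c2 : R -> R) t a b u w : PD f (c1 t, c2 t) a b ->
  is_derive t 1 c1 u -> is_derive t 1 c2 w ->
  is_derive t 1 (fun s => f (c1 s, c2 s)) (a * u + b * w).
Proof.
move=> [df fE] [d1 E1] [d2 E2].
move: d1 d2 => /derivable1_diffP d1 /derivable1_diffP d2.
have dc : differentiable (fun s => (c1 s, c2 s)) t by exact: differentiable_pair.
have dfc : differentiable (f \o (fun s => (c1 s, c2 s))) t by exact: differentiable_comp.
apply: DeriveDef; first exact/diff_derivable.
rewrite -[LHS]/('D_1 (f \o (fun s => (c1 s, c2 s))) t) deriveE//.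
rewrite (diff_comp dc df) fE diff_pair//= -!deriveE// E1 E2.
by rewrite /lin2/=; ring.
Qed.

Lemma PD_comp1 (k : R -> R) f p a b l : PD f p a b -> is_derive (f p) 1 k l ->
  PD (fun q => k (f q)) p (l * a) (l * b).
Proof.
move=> [df fE] [dk kE]; move/derivable1_diffP : dk => dk.
split; first exact: differentiable_comp.
rewrite (diff_comp df dk) fE; apply/funext => v /=.
have -> : 'd k (f p) (lin2 a b v) = lin2 a b v *: 'd k (f p) 1.
  by rewrite -linearZ; congr ('d k (f p) _); rewrite /GRing.scale/= mulr1.
by rewrite -deriveE// kE /lin2 /GRing.scale/=; ring.
Qed.

Lemma PD_continuous f p a b : PD f p a b -> {for p, continuous f}.
Proof. by move=> [df _]; exact: differentiable_continuous. Qed.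

End Plane.

(** * Functions of class C^k on an open set of the plane *)

Section Ck.
Context {R : realType}.
Notation plane := (R * R)%type.
Implicit Types (f g : plane -> R) (p q v : plane) (h : plane -> plane)
  (U V : set plane).

Lemma near_box (P : plane -> Prop) p : (\forall q \near p, P q) <->
  exists2 d : R, 0 < d &
    forall q, `|q.1 - p.1| < d -> `|q.2 - p.2| < d -> P q.
Proof.
split=> [/nbhs_ballP[d /= d0 dP]|[d d0 dP]].
  exists d => // q q1 q2; apply: dP; split; rewrite /ball/= distrC//.
apply/nbhs_ballP; exists d => //= q [q1 q2]; apply: dP; rewrite distrC//.
Qed.

Lemma continuous_box f p : {for p, continuous f} -> forall e : R, 0 < e ->
  exists2 d : R, 0 < d &
    forall q, `|q.1 - p.1| < d -> `|q.2 - p.2| < d -> `|f q - f p| < e.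
Proof.
move=> /cvgrPdist_lt fp e e0; apply/near_box.
by apply: filterS (fp e e0) => q; rewrite distrC.
Qed.

Lemma derivable_dirx f p : derivable f p (dir R true) ->
  is_derive p.1 1 (fun s => f (s, p.2)) (dx f p).
Proof.
case: p => x y fp. have E : (fun h : R => h^-1 *: ((f \o shift (x, y)) (h *: dir R true) - f (x, y)))
    = (fun h : R => h^-1 *: (((fun s => f (s, y)) \o shift x) (h *: 1) - f (x, y))).
  apply/funext => h; congr (_ *: (f _ - _)).
  by rewrite -[LHS]/(h * 1 + x, h * 0 + y) mulr0 add0r.
by apply: DeriveDef; rewrite ?/derivable /dx /derive/= -?E.
Qed.

Lemma derivable_diry f p : derivable f p (dir R false) ->
  is_derive p.2 1 (fun s => f (p.1, s)) (dy f p).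
Proof.
case: p => x y fp. have E : (fun h : R => h^-1 *: ((f \o shift (x, y)) (h *: dir R false) - f (x, y)))
    = (fun h : R => h^-1 *: (((fun s => f (x, s)) \o shift y) (h *: 1) - f (x, y))).
  apply/funext => h; congr (_ *: (f _ - _)).
  by rewrite -[LHS]/(h * 0 + x, h * 1 + y) mulr0 add0r.
by apply: DeriveDef; rewrite ?/derivable /dy /derive/= -?E.
Qed.

Lemma PD_x f x y a b : PD f (x, y) a b -> is_derive x 1 (fun s => f (s, y)) a.
Proof.
move=> fp; rewrite -(PD_dx fp); apply: (@derivable_dirx f (x, y)).
by apply: diff_derivable; case: fp.
Qed.

Lemma PD_y f x y a b : PD f (x, y) a b -> is_derive y 1 (fun s => f (x, s)) b.
Proof.
move=> fp; rewrite -(PD_dy fp); apply: (@derivable_diry f (x, y)).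
by apply: diff_derivable; case: fp.
Qed.

Lemma between_dist (x y s d : R) : Num.min x y <= s <= Num.max x y ->
  `|y - x| < d -> `|s - x| < d.
Proof.
rewrite !ltr_norml; case: (leP x y) => xy /andP[] ? ? /andP[] ? ?;
  apply/andP; split; lra.
Qed.

(** The increment is cut at the corner [(p.1, v.2 + p.2)] into a horizontal and a vertical piece. On
    each, the mean value estimate compares with the partial at [p], at a cost of [e / 2] per
    coordinate. *)
Lemma partials_PD f p :
  (\forall q \near p, derivable f q (dir R true) /\ derivable f q (dir R false)) ->
  {for p, continuous (dx f)} -> {for p, continuous (dy f)} ->
  PD f p (dx f p) (dy f p).
Proof.
move=> /near_box[d1 d1_0 fd] cx cy; apply: PD_littleo => e e0.
have e20 : 0 < e / 2 by rewrite divr_gt0.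
have [d2 d2_0 fx] := continuous_box cx e20.
have [d3 d3_0 fy] := continuous_box cy e20.
pose d := Num.min d1 (Num.min d2 d3).
have d0 : 0 < d by rewrite !lt_min d1_0 d2_0.
have ltd r : r < d -> [/\ r < d1, r < d2 & r < d3].
  by rewrite !lt_min => /and3P[].
apply/near_box; exists d => // v; rewrite /= !subr0 => v1 v2.
have [v11 v12 v13] := ltd _ v1; have [v21 v22 v23] := ltd _ v2.
have X : `|f (v.1 + p.1, v.2 + p.2) - f (p.1, v.2 + p.2) - dx f p * (v.1 + p.1 - p.1)|
    <= e / 2 * `|v.1 + p.1 - p.1|.
  apply: (@MVT_dist _ (fun s => f (s, v.2 + p.2)) (fun s => dx f (s, v.2 + p.2))).
  move=> s sb; have sd r : `|v.1| < r -> `|s - p.1| < r.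
    by move=> vr; apply: between_dist sb _; rewrite addrK.
  have b1 : `|(s, v.2 + p.2).1 - p.1| < d1 by exact: sd.
  have b2 : `|(s, v.2 + p.2).2 - p.2| < d1 by rewrite /= addrK.
  split; first exact: derivable_dirx (fd _ b1 b2).1.
  by apply/ltW/fx; [exact: sd|rewrite /= addrK].
have Y : `|f (p.1, v.2 + p.2) - f (p.1, p.2) - dy f p * (v.2 + p.2 - p.2)|
    <= e / 2 * `|v.2 + p.2 - p.2|.
  apply: (@MVT_dist _ (fun s => f (p.1, s)) (fun s => dy f (p.1, s))).
  move=> s sb; have sd r : `|v.2| < r -> `|s - p.2| < r.
    by move=> vr; apply: between_dist sb _; rewrite addrK.
  have b1 : `|(p.1, s).1 - p.1| < d1 by rewrite /= subrr normr0.
  have b2 : `|(p.1, s).2 - p.2| < d1 by exact: sd.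
  split; first exact: derivable_diry (fd _ b1 b2).2.
  by apply/ltW/fy; [rewrite /= subrr normr0|exact: sd].
rewrite !addrK in X Y; have := lerD X Y.
have n1 := norm_fst_le v; have n2 := norm_snd_le v.
move=> XY; have {}XY := le_trans (ler_normD _ _) XY.
have -> : f (v + p) - f p - lin2 (dx f p) (dy f p) v =
  f (v.1 + p.1, v.2 + p.2) - f (p.1, v.2 + p.2) - dx f p * v.1 +
    (f (p.1, v.2 + p.2) - f (p.1, p.2) - dy f p * v.2).
  rewrite /lin2; case: p v {fd cx cy fx fy v1 v2 v11 v12 v13 v21 v22 v23 X Y n1 n2 XY} => x y [a b] /=.
  by rewrite -[(a, b) + (x, y)]/(a + x, b + y); ring.
have -> : e * `|v| = e / 2 * (`|v| + `|v|) by field.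
by apply: le_trans XY _; rewrite -mulrDr ler_wpM2l ?(ltW e20)// lerD.
Qed.

(** Total differentiability is built in at each level, so that closure under sums, products and
    composition is an induction on [k]. On an open set, all [k] together amount to [smooth_on]. *)
Fixpoint Ck k U f : Prop := match k with
  | 0 => forall p, U p -> {for p, continuous f}
  | k'.+1 => (forall p, U p -> differentiable f p) /\ Ck k' U (dx f) /\ Ck k' U (dy f)
  end.

Lemma Ck_PD k U f p : Ck k.+1 U f -> U p -> PD f p (dx f p) (dy f p).
Proof. by move=> [fd _] Up; exact/differentiable_PD/fd. Qed.

Lemma Ck_dx k U f : Ck k.+1 U f -> Ck k U (dx f).
Proof. by move=> [_ []]. Qed.

Lemma Ck_dy k U f : Ck k.+1 U f -> Ck k U (dy f).
Proof. by move=> [_ []]. Qed.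

Lemma Ck_sub k U V f : V `<=` U -> Ck k U f -> Ck k V f.
Proof.
move=> VU; elim: k f => [|k IH] f /=; first by move=> + p /VU; apply.
by move=> [fd [fx fy]]; split=> [p /VU /fd //|]; split; exact: IH.
Qed.

Lemma CkS k U f : Ck k.+1 U f -> Ck k U f.
Proof.
elim: k f => [|k IH] f [fd [fx fy]].
  by move=> p /fd; exact: differentiable_continuous.
split; first exact: fd.
by split; [exact: (IH _ fx)|exact: (IH _ fy)].
Qed.

Lemma Ck_continuous k U f p : Ck k U f -> U p -> {for p, continuous f}.
Proof. by elim: k => [|k IH]; [exact|move/CkS]. Qed.

Lemma dx_near f g p : (\forall q \near p, f q = g q) -> dx f p = dx g p.
Proof. by move=> fg; rewrite /dx/=; exact: near_eq_derive. Qed.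

Lemma dy_near f g p : (\forall q \near p, f q = g q) -> dy f p = dy g p.
Proof. by move=> fg; rewrite /dy/=; exact: near_eq_derive. Qed.

Lemma near_open U f g p : open U -> (forall q, U q -> f q = g q) -> U p ->
  \forall q \near p, f q = g q.
Proof. by move=> oU fg Up; apply: filterS (open_nbhs_nbhs (conj oU Up)). Qed.

Lemma Ck_eq k U f g : open U -> (forall p, U p -> f p = g p) ->
  Ck k U f -> Ck k U g.
Proof.
move=> oU; elim: k f g => [|k IH] f g fg /=.
  move=> fc p Up; rewrite /prop_for /continuous_at -(fg p Up).
  by apply: cvg_trans (fc p Up); apply: near_eq_cvg; exact: near_open fg Up.
move=> [fd [fx fy]]; split=> [p Up|].
  have fgp := near_open oU fg Up.
  by have [] := PD_near_eq fgp (differentiable_PD (fd p Up)).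
split; [apply: IH fx|apply: IH fy] => p Up.
- exact/dx_near/(near_open oU).
- exact/dy_near/(near_open oU).
Qed.

Lemma Ck_of_PD k U f a b : open U -> (forall p, U p -> PD f p (a p) (b p)) ->
  Ck k U a -> Ck k U b -> Ck k.+1 U f.
Proof.
move=> oU fab ca cb; split=> [p /fab[]//|].
by split; [apply: Ck_eq ca|apply: Ck_eq cb] => // p /fab fp;
  rewrite ?(PD_dx fp) ?(PD_dy fp).
Qed.

Lemma Ck_cst k U (c : R) : open U -> Ck k U (fun=> c).
Proof.
move=> oU; elim: k c => [|k IH] c; first by move=> p _; exact: cvg_cst.
by apply: (Ck_of_PD oU) (IH 0) (IH 0) => p _; exact: PD_cst.
Qed.

Lemma Ck_fst k U : open U -> Ck k U fst.
Proof.
move=> oU; case: k => [p _|k]; first exact: continuous_fst.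
by apply: (Ck_of_PD oU) (Ck_cst _ _ oU) (Ck_cst _ _ oU) => p _; exact: PD_fst.
Qed.

Lemma Ck_snd k U : open U -> Ck k U snd.
Proof.
move=> oU; case: k => [p _|k]; first exact: continuous_snd.
by apply: (Ck_of_PD oU) (Ck_cst _ _ oU) (Ck_cst _ _ oU) => p _; exact: PD_snd.
Qed.

Lemma Ck_D k U f g : open U -> Ck k U f -> Ck k U g -> Ck k U (fun p => f p + g p).
Proof.
move=> oU; elim: k f g => [|k IH] f g cf cg.
  by move=> p Up; apply: cvgD; [exact: cf|exact: cg].
apply: (Ck_of_PD oU) (IH _ _ (Ck_dx cf) (Ck_dx cg)) (IH _ _ (Ck_dy cf) (Ck_dy cg)).
by move=> p Up; exact: PD_D (Ck_PD cf Up) (Ck_PD cg Up).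
Qed.

Lemma Ck_M k U f g : open U -> Ck k U f -> Ck k U g -> Ck k U (fun p => f p * g p).
Proof.
move=> oU; elim: k f g => [|k IH] f g cf cg.
  by move=> p Up; apply: cvgM; [exact: cf|exact: cg].
have [cf' cg'] := (CkS cf, CkS cg).
apply: (Ck_of_PD oU _ (Ck_D oU (IH _ _ (Ck_dx cf) cg') (IH _ _ cf' (Ck_dx cg)))
  (Ck_D oU (IH _ _ (Ck_dy cf) cg') (IH _ _ cf' (Ck_dy cg)))).
by move=> p Up; exact: PD_M (Ck_PD cf Up) (Ck_PD cg Up).
Qed.

Lemma Ck_Z k U (c : R) f : open U -> Ck k U f -> Ck k U (fun p => c * f p).
Proof. by move=> oU; apply: Ck_M => //; exact: Ck_cst. Qed.

Lemma Ck_N k U f : open U -> Ck k U f -> Ck k U (fun p => - f p).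
Proof.
move=> oU cf; apply: Ck_eq (Ck_Z (-1) oU cf) => // p _.
by rewrite mulN1r.
Qed.

Lemma continuous_plane (T : topologicalType) f (h : T -> plane) (p : T) : {for h p, continuous f} ->
  {for p, continuous (fun r => (h r).1)} -> {for p, continuous (fun r => (h r).2)} ->
  {for p, continuous (fun r => f (h r))}.
Proof.
move=> cf c1 c2; apply/cvgrPdist_lt => e e0.
have [d d0 fd] := continuous_box cf e0.
move/cvgrPdist_lt : c1 => /(_ _ d0) n1; move/cvgrPdist_lt : c2 => /(_ _ d0) n2.
apply: filterS2 n1 n2 => q q1 q2.
by rewrite distrC; apply: fd; rewrite distrC.
Qed.

Lemma Ck_comp k U V f h : open U -> (forall p, U p -> V (h p)) -> Ck k V f ->
  Ck k U (fun q => (h q).1) -> Ck k U (fun q => (h q).2) ->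
  Ck k U (fun q => f (h q)).
Proof.
move=> oU UV; elim: k f => [|k IH] f cf c1 c2.
  by move=> p Up; apply: continuous_plane; [exact/cf/UV|exact: c1|exact: c2].
have [c1' c2'] := (CkS c1, CkS c2).
apply: (Ck_of_PD oU _ (Ck_D oU (Ck_M oU (IH _ (Ck_dx cf) c1' c2') (Ck_dx c1))
    (Ck_M oU (IH _ (Ck_dy cf) c1' c2') (Ck_dx c2)))
  (Ck_D oU (Ck_M oU (IH _ (Ck_dx cf) c1' c2') (Ck_dy c1))
    (Ck_M oU (IH _ (Ck_dy cf) c1' c2') (Ck_dy c2)))).
move=> p Up; exact: PD_comp (Ck_PD cf (UV _ Up)) (Ck_PD c1 Up) (Ck_PD c2 Up).
Qed.

Lemma Ck_cos_sin k U f : open U -> Ck k U f ->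
  Ck k U (fun p => cos (f p)) /\ Ck k U (fun p => sin (f p)).
Proof.
move=> oU; elim: k => [|k IH] cf.
  by split=> p Up; (apply: continuous_comp; first exact: cf);
    [exact: continuous_cos|exact: continuous_sin].
have [cc cs] := IH (CkS cf); split.
- apply: (Ck_of_PD oU _ (Ck_M oU (Ck_N oU cs) (Ck_dx cf))
    (Ck_M oU (Ck_N oU cs) (Ck_dy cf))) => p Up.
  by apply: PD_comp1 (Ck_PD cf Up) _; exact: is_derive_cos.
- apply: (Ck_of_PD oU _ (Ck_M oU cc (Ck_dx cf)) (Ck_M oU cc (Ck_dy cf))) => p Up.
  by apply: PD_comp1 (Ck_PD cf Up) _; exact: is_derive_sin.
Qed.

(** [pd] is recursive in the outermost derivative and [Ck] in the innermost one; this identity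
    passes between the two orders. *)
Lemma pd_rcons w b f : pd (rcons w b) f = pd w (pd [:: b] f).
Proof. by elim: w => [|c w IH] //=; rewrite IH. Qed.

Lemma smooth_on_pd U b f : smooth_on U f -> smooth_on U (pd [:: b] f).
Proof. by move=> [oU sf]; split=> // w p Up; rewrite -pd_rcons; exact: sf. Qed.

Lemma smooth_on_Ck k U f : smooth_on U f -> Ck k U f.
Proof.
elim: k f => [|k IH] f sf; first by case: sf => _ sf p /(sf [::])[].
split; last by split; apply: IH; exact: smooth_on_pd sf.
move=> p Up; case: sf => oU sf.
have [] := @partials_PD f p; last by [].
- apply: filterS (open_nbhs_nbhs (conj oU Up)) => q Uq.
  by have [sx sy _] := sf [::] q Uq; exact: (conj sx sy).
- by have [] := sf [:: true] p Up.
- by have [] := sf [:: false] p Up.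
Qed.

Lemma Ck_smooth_on U f : open U -> (forall k, Ck k U f) -> smooth_on U f.
Proof.
move=> oU cf; split=> // w; elim/last_ind: w f cf => [|w b IH] f cf p Up.
  have [fd _] := cf 1%N.
  split; [exact/diff_derivable/fd|exact/diff_derivable/fd|exact: (cf 0%N)].
by rewrite pd_rcons; apply: IH => // k; case: b; have [_ []] := cf k.+1.
Qed.

End Ck.

(** * Symmetry of second derivatives and integrals over the unit interval *)

(* Unification would otherwise unfold the limits that define dx and dy. *)
Opaque dx dy.

Section Schwarz.
Context {R : realType}.
Notation plane := (R * R)%type.
Implicit Types (f : plane -> R) (U : set plane).

Lemma open_box U (p : plane) : open U -> U p -> exists2 d : R, 0 < d &
  forall q, `|q.1 - p.1| < d -> `|q.2 - p.2| < d -> U q.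
Proof. by move=> oU Up; apply/near_box; exact: open_nbhs_nbhs. Qed.

(** The second difference of [f] over the square of side [h] at [p] is [h * h] times a mixed
    derivative at some point of the square, in whichever order the mean value theorem is applied
    twice. Continuity at [p] then puts the two mixed derivatives within any [e] of each other. *)
Lemma dxdy U f p : open U -> Ck 2 U f -> U p -> dx (dy f) p = dy (dx f) p.
Proof.
case: p => x y oU cf Up; apply/eqP; rewrite -subr_eq0 -normr_le0.
apply/ler_addgt0Pr => e e0; rewrite add0r.
have e20 : 0 < e / 2 by rewrite divr_gt0.
have [d1 d1_0 Ud] := open_box oU Up.
have cxy : Ck 0 U (dx (dy f)) := Ck_dx (Ck_dy cf).
have cyx : Ck 0 U (dy (dx f)) := Ck_dy (Ck_dx cf).
have [d2 d2_0 fxy] := continuous_box (cxy _ Up) e20.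
have [d3 d3_0 fyx] := continuous_box (cyx _ Up) e20.
pose d := Num.min d1 (Num.min d2 d3); pose h := d / 2.
have d0 : 0 < d by rewrite !lt_min d1_0 d2_0.
have h0 : 0 < h by rewrite divr_gt0.
have [hd1 hd2 hd3] : [/\ h < d1, h < d2 & h < d3].
  have : h < d by rewrite /h; lra.
  by rewrite !lt_min => /and3P[].
have minx (z : R) : Num.min z (z + h) = z by rewrite min_l//; lra.
have maxx (z : R) : Num.max z (z + h) = z + h by rewrite max_r//; lra.
have box r (z s : R) : h < r -> z <= s <= z + h -> `|s - z| < r.
  by move=> ? /andP[? ?]; rewrite ltr_norml; apply/andP; split; lra.
have UU a b : x <= a <= x + h -> y <= b <= y + h -> U (a, b).
  by move=> xa yb; apply: Ud; exact: box.
have xx : x <= x <= x + h by rewrite lexx/=; lra.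
have yy : y <= y <= y + h by rewrite lexx/=; lra.
have xh : x <= x + h <= x + h by rewrite lexx andbT; lra.
have yh : y <= y + h <= y + h by rewrite lexx andbT; lra.
have [|c1 c1x E1] := @MVT_between _ (fun s => f (s, y + h) - f (s, y))
    (fun s => dx f (s, y + h) - dx f (s, y)) x (x + h).
  rewrite minx maxx => s sx; apply: is_deriveB; apply: PD_x;
    apply: Ck_PD cf _; exact: UU.
rewrite minx maxx in c1x.
have [|c2 c2y E2] := @MVT_between _ (fun s => dx f (c1, s))
    (fun s => dy (dx f) (c1, s)) y (y + h).
  rewrite minx maxx => s sx; apply: PD_y; apply: Ck_PD (Ck_dx cf) _; exact: UU.
rewrite minx maxx in c2y.
have [|b1 b1y E3] := @MVT_between _ (fun s => f (x + h, s) - f (x, s))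
    (fun s => dy f (x + h, s) - dy f (x, s)) y (y + h).
  rewrite minx maxx => s sx; apply: is_deriveB; apply: PD_y;
    apply: Ck_PD cf _; exact: UU.
rewrite minx maxx in b1y.
have [|b2 b2x E4] := @MVT_between _ (fun s => dy f (s, b1))
    (fun s => dx (dy f) (s, b1)) x (x + h).
  rewrite minx maxx => s sx; apply: PD_x; apply: Ck_PD (Ck_dy cf) _; exact: UU.
rewrite minx maxx in b2x.
have E : dx (dy f) (b2, b1) = dy (dx f) (c1, c2).
  have hh : h * h != 0 by rewrite mulf_neq0 ?gt_eqF.
  have sw4 (r1 r2 r3 r4 : R) : r1 - r2 - (r3 - r4) = r1 - r3 - (r2 - r4) by ring.
  have E13 := etrans (esym E1) (etrans (sw4 _ _ _ _) E3).
  have key (u a w b k l : R) : u = b * k -> w = a * l -> k = h -> l = h ->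
      u * l = w * k -> a = b.
    move=> -> -> -> -> H; apply: (mulIf hh); rewrite mulrA -H; ring.
  by apply: key E2 E4 _ _ E13; ring.
have F1 := fxy (b2, b1) (box _ _ _ hd2 b2x) (box _ _ _ hd2 b1y).
have F2 := fyx (c1, c2) (box _ _ _ hd3 c1x) (box _ _ _ hd3 c2y).
rewrite E in F1; move: F1 F2.
generalize (dx (dy f) (x, y)) (dy (dx f) (x, y)) (dy (dx f) (c1, c2)) => r1 r2 r3.
rewrite !ltr_norml ler_norml.
by move=> /andP[? ?] /andP[? ?]; apply/andP; split; lra.
Qed.

End Schwarz.

Section Int01.
Context {R : realType}.
Notation mu := (@lebesgue_measure R).
Implicit Types (f g F : R -> R).

Definition cont01 f := forall t : R, 0 <= t <= 1 -> {for t, continuous f}.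

Definition int01 f : R := Rintegral mu `[0, 1] f.

Lemma cont01_within f : cont01 f -> {within `[0, 1], continuous f}.
Proof.
move=> cf; apply: continuous_in_subspaceT => t; rewrite inE/= in_itv/=; exact: cf.
Qed.

Lemma cont01_integrable f : cont01 f -> mu.-integrable `[0, 1] (EFin \o f).
Proof.
by move=> cf; apply: continuous_compact_integrable;
  [exact: segment_compact|exact: cont01_within].
Qed.

Lemma cont01D f g : cont01 f -> cont01 g -> cont01 (fun t => f t + g t).
Proof. by move=> cf cg t t01; apply: cvgD; [exact: cf|exact: cg]. Qed.

Lemma cont01B f g : cont01 f -> cont01 g -> cont01 (fun t => f t - g t).
Proof. by move=> cf cg t t01; apply: cvgB; [exact: cf|exact: cg]. Qed.

Lemma cont01M f g : cont01 f -> cont01 g -> cont01 (fun t => f t * g t).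
Proof. by move=> cf cg t t01; apply: cvgM; [exact: cf|exact: cg]. Qed.

Lemma cont01_cst (c : R) : cont01 (fun=> c).
Proof. by move=> t _; exact: cvg_cst. Qed.

Lemma cont01X k : cont01 (fun t => t ^+ k).
Proof. by move=> t _; exact: exprn_continuous. Qed.

Lemma int01D f g : cont01 f -> cont01 g ->
  int01 (fun t => f t + g t) = int01 f + int01 g.
Proof. by move=> cf cg; rewrite /int01 RintegralD//; exact: cont01_integrable. Qed.

Lemma int01Z (c : R) f : cont01 f -> int01 (fun t => c * f t) = c * int01 f.
Proof. by move=> cf; rewrite /int01 RintegralZl//; exact: cont01_integrable. Qed.

Lemma int01B f g : cont01 f -> cont01 g ->
  int01 (fun t => f t - g t) = int01 f - int01 g.
Proof. by move=> cf cg; rewrite /int01 RintegralB//; exact: cont01_integrable. Qed.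

Lemma eq_int01 f g : (forall t : R, 0 <= t <= 1 -> f t = g t) -> int01 f = int01 g.
Proof.
by move=> fg; apply: eq_Rintegral => t; rewrite inE/= in_itv/= => /fg.
Qed.

Lemma int01_cst (c : R) : int01 (fun=> c) = c.
Proof.
by rewrite /int01 Rintegral_cst//= lebesgue_measure_itv//= lte01 oppr0 addr0 mulr1.
Qed.

Lemma int01_bound f (c : R) : cont01 f -> (forall t : R, 0 <= t <= 1 -> `|f t| <= c) ->
  `|int01 f| <= c.
Proof.
move=> cf fc; have If := cont01_integrable cf.
apply: le_trans (le_normr_Rintegral _ If) _ => //.
rewrite -[leRHS]int01_cst; apply: le_Rintegral => //.
- by have /integrable_norm := If.
- exact/cont01_integrable/cont01_cst.
Qed.

Lemma int01_FTC f F : cont01 f ->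
  (forall t : R, 0 <= t <= 1 -> is_derive t 1 F (f t)) -> int01 f = F 1 - F 0.
Proof.
move=> cf Ff; have cF (t : R) : 0 <= t <= 1 -> {for t, continuous F}.
  move=> t01; apply: differentiable_continuous; apply/derivable1_diffP.
  by have [] := Ff t t01.
rewrite /int01 /Rintegral (@continuous_FTC2 _ f F)//.
- exact: cont01_within.
- split.
  + by move=> t; rewrite in_itv/= => /andP[/ltW t0 /ltW t1]; have [|] := Ff t _; rewrite ?t0 ?t1.
  + by apply: cvg_at_right_filter; apply: cF; rewrite lexx ler01.
  + by apply: cvg_at_left_filter; apply: cF; rewrite lexx ler01.
- move=> t; rewrite in_itv/= => /andP[/ltW t0 /ltW t1]; rewrite derive1E.
  by have [|] := Ff t _; rewrite ?t0 ?t1.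
Qed.

End Int01.
Arguments cont01_cst {R} c t _.

(** * Radial integrals and potentials of closed 1-forms *)

Section Radial.
Context {R : realType}.
Notation plane := (R * R)%type.
Implicit Types (f g : plane -> R) (p q v : plane).

Definition nsq p : R := p.1 ^+ 2 + p.2 ^+ 2.

Definition sc (t : R) p : plane := (t * p.1, t * p.2).

Definition dball (rho : R) : set plane := [set p | nsq p < rho].

Lemma nsq_ge0 p : 0 <= nsq p.
Proof. by rewrite addr_ge0// sqr_ge0. Qed.

Lemma nsq_sc t p : nsq (sc t p) = t ^+ 2 * nsq p.
Proof. by rewrite /nsq/=; ring. Qed.

Lemma sqr01 (t : R) : 0 <= t <= 1 -> t ^+ 2 <= 1.
Proof. by move=> /andP[t0 t1]; rewrite exprn_ile1. Qed.

Lemma dball_sc rho t p : 0 <= t <= 1 -> dball rho p -> dball rho (sc t p).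
Proof.
move=> t01 Bp; rewrite /dball/= nsq_sc; apply: le_lt_trans Bp.
by rewrite ler_piMl ?nsq_ge0 ?sqr01.
Qed.

Lemma disk_sc t p : 0 <= t <= 1 -> @disk R p -> @disk R (sc t p).
Proof.
move=> t01 Dp; have := nsq_sc t p; rewrite /disk/= /nsq/= => ->.
by apply: le_trans Dp; rewrite ler_piMl ?nsq_ge0 ?sqr01.
Qed.

Lemma PD_nsq p : PD nsq p (2 * p.1) (2 * p.2).
Proof.
have -> : nsq = (fun q => q.1 * q.1 + q.2 * q.2).
  by apply/funext => q; rewrite /nsq !expr2.
by apply: PD_eq (PD_D (PD_M (PD_fst p) (PD_fst p)) (PD_M (PD_snd p) (PD_snd p))) _ _; ring.
Qed.

Lemma nsq_continuous : continuous nsq.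
Proof. by move=> p; exact: PD_continuous (PD_nsq p). Qed.

Lemma open_dball rho : open (dball rho).
Proof.
have -> : dball rho = nsq @^-1` [set r | r < rho] by [].
by apply: open_comp => //; move=> p _; exact: nsq_continuous.
Qed.

Arguments open_dball : clear implicits.

Lemma disk_dball rho : 1 < rho -> @disk R `<=` dball rho.
Proof. by move=> r1 p Dp; exact: le_lt_trans r1. Qed.

(** Compactness of [0, 1] makes continuity along the segment from [o] to [p] uniform in [t]; its
    near-covering form asks only for an estimate around each [t0], in [t] and [q] together. *)
Lemma sc_uniform f p (e : R) :
  (forall t : R, 0 <= t <= 1 -> {for sc t p, continuous f}) -> 0 < e ->
  exists2 d : R, 0 < d & forall q, `|q.1 - p.1| < d -> `|q.2 - p.2| < d ->
    forall t : R, 0 <= t <= 1 -> `|f (sc t q) - f (sc t p)| < e.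
Proof.
move=> cf e0; apply/near_box.
have /compact_near_coveringP cK := @segment_compact R 0 1.
suff : \forall q \near p, `[0, 1] `<=` (fun t : R => `|f (sc t q) - f (sc t p)| < e).
  by apply: filterS => q qP t t01; apply: qP; rewrite /= in_itv.
apply: (cK plane (nbhs p) (fun q t => `|f (sc t q) - f (sc t p)| < e)) => t0; rewrite /= in_itv/= => t01.
have e20 : 0 < e / 2 by rewrite divr_gt0.
have [d1 d1_0 fd] := continuous_box (cf t0 t01) e20.
have n1 := normr_ge0 p.1; have n2 := normr_ge0 p.2.
(* In [est] the displacement of each coordinate is at most [(2 + |p.1| + |p.2|) * d], as [|t| <= 2];
   taking 3 in place of 2 makes the final inequality strict. *)
pose m := 3 + `|p.1| + `|p.2|.
have m0 : 0 < m by rewrite /m; lra.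
pose d := Num.min 1 (d1 / m).
have d0 : 0 < d by rewrite lt_min ltr01 divr_gt0.
have dd : d * m <= d1 by rewrite -ler_pdivlMr// ge_min lexx orbT.
have d1' : d <= 1 by rewrite ge_min lexx.
have est (t x y : R) : `|t - t0| < d -> `|y - x| < d -> `|x| <= `|p.1| + `|p.2| ->
    `|t * y - t0 * x| < d1.
  move=> tt yx xp; have -> : t * y - t0 * x = t * (y - x) + (t - t0) * x by ring.
  apply: le_lt_trans (ler_normD _ _) _; rewrite !normrM.
  have t2 : `|t| <= 2.
    by move: tt t01; rewrite ltr_norml ler_norml => /andP[? ?] /andP[? ?];
      apply/andP; split; lra.
  have A : `|t| * `|y - x| <= 2 * d by apply: ler_pM => //; exact: ltW.
  have B : `|t - t0| * `|x| <= d * (`|p.1| + `|p.2|) by apply: ler_pM => //; exact: ltW.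
  apply: le_lt_trans (lerD A B) _; apply: lt_le_trans dd.
  by rewrite /m; have := d0; nra.
have p1 : `|p.1| <= `|p.1| + `|p.2| by lra.
have p2 : `|p.2| <= `|p.1| + `|p.2| by lra.
exists ([set t : R | `|t - t0| < d],
  [set q : plane | `|q.1 - p.1| < d /\ `|q.2 - p.2| < d]).
  split => /=; last by apply/near_box; exists d.
  by apply/nbhs_ballP; exists d => // t; rewrite /ball/= distrC.
move=> [t q] /= [tt [q1 q2]].
have F1 : `|f (sc t q) - f (sc t0 p)| < e / 2.
  by apply: fd; rewrite /sc/=; apply: est.
have F2 : `|f (sc t p) - f (sc t0 p)| < e / 2.
  by apply: fd; rewrite /sc/=; apply: est => //; rewrite subrr normr0.
have -> : f (sc t q) - f (sc t p) =
    f (sc t q) - f (sc t0 p) - (f (sc t p) - f (sc t0 p)) by ring.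
by apply: le_lt_trans (ler_normB _ _) _; rewrite (splitr e) ltrD.
Qed.

(** Differentiation under the integral raises the weight [k] by one. Weight 0 occurs in the Poincare
    lemma, and weight 1 is the function m with f omega = d(2 m eta). *)
Definition radint (k : nat) f p : R := int01 (fun t => t ^+ k * f (sc t p)).

Lemma is_derive_scale (t x : R) : is_derive t 1 (fun s => s * x) x.
Proof.
apply: eq_is_derive (is_deriveM (is_derive_id t 1) (is_derive_cst x t 1)) _.
by rewrite scaler0 add0r /GRing.scale/= mulr1.
Qed.

Lemma is_derive_continuous (F : R -> R) (t l : R) :
  is_derive t 1 F l -> {for t, continuous F}.
Proof.
by move=> [dF _]; apply/differentiable_continuous/derivable1_diffP.
Qed.

Lemma cont01_sc f p : (forall t : R, 0 <= t <= 1 -> {for sc t p, continuous f}) ->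
  cont01 (fun t => f (sc t p)).
Proof.
move=> cf t t01; apply: continuous_plane; first exact: cf.
- exact: is_derive_continuous (is_derive_scale t p.1).
- exact: is_derive_continuous (is_derive_scale t p.2).
Qed.

Section OnBall.
Variable rho : R.
Notation B := (dball rho).
Let oB : open B := open_dball rho.

Lemma Ck_sc j f p t : Ck j B f -> B p -> 0 <= t <= 1 -> {for sc t p, continuous f}.
Proof. by move=> cf Bp t01; apply: Ck_continuous cf _; exact: dball_sc. Qed.

Lemma cont01_radint k j f p : Ck j B f -> B p ->
  cont01 (fun t => t ^+ k * f (sc t p)).
Proof.
move=> cf Bp; apply: cont01M; first exact: cont01X.
by apply: cont01_sc => t t01; exact: Ck_sc cf Bp t01.
Qed.

Arguments cont01_radint k [j f p] _ _ _ _.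

Lemma exp01 k (t : R) : 0 <= t <= 1 -> 0 <= t ^+ k <= 1.
Proof. by move=> /andP[t0 t1]; rewrite exprn_ge0//= exprn_ile1. Qed.

Lemma radint_continuous k f : Ck 0 B f -> Ck 0 B (radint k f).
Proof.
move=> cf p Bp; apply/cvgrPdist_le => e e0.
have [d d0 fd] := sc_uniform (fun t => Ck_sc cf Bp (t:=t)) e0.
have [d2 d2_0 Bd] := open_box (open_dball rho) Bp.
apply/near_box; exists (Num.min d d2); first by rewrite lt_min d0 d2_0.
move=> q; rewrite !lt_min => /andP[q1 q1'] /andP[q2 q2'].
have Bq := Bd q q1' q2'; rewrite distrC /radint -int01B; try exact: cont01_radint cf _.
apply: int01_bound.
  by apply: cont01B; apply: cont01_radint cf _.
move=> t t01; have /andP[k0 k1] := exp01 k t01.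
rewrite -mulrBr normrM (ger0_norm k0); apply: le_trans (ltW (fd q q1 q2 t t01)).
exact: ler_piMl.
Qed.

(** Differentiation under the integral sign. For each [t] the mean value estimate bounds the
    remainder by [e * |v|], and [sc_uniform] makes the neighbourhood independent of [t]. *)
Lemma radint_PD k f p : Ck 1 B f -> B p ->
  PD (radint k f) p (radint k.+1 (dx f) p) (radint k.+1 (dy f) p).
Proof.
move=> cf Bp; apply: PD_littleo => e e0.
have e20 : 0 < e / 2 by rewrite divr_gt0.
have cx := Ck_dx cf; have cy := Ck_dy cf.
have [d1 d10 fx] := sc_uniform (fun t => Ck_sc cx Bp (t:=t)) e20.
have [d2 d20 fy] := sc_uniform (fun t => Ck_sc cy Bp (t:=t)) e20.
have [d3 d30 Bd] := open_box (open_dball rho) Bp.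
pose d := Num.min d1 (Num.min d2 d3).
have d0 : 0 < d by rewrite !lt_min d10 d20.
apply/near_box; exists d => // v; rewrite /= !subr0.
rewrite !lt_min => /and3P[v11 v12 v13] /and3P[v21 v22 v23].
have Bv (s : R) : 0 <= s <= 1 -> forall r : R, `|v.1| < r -> `|v.2| < r ->
    `|(s * v.1 + p.1, s * v.2 + p.2).1 - p.1| < r /\ `|(s * v.1 + p.1, s * v.2 + p.2).2 - p.2| < r.
  move=> /andP[s0 s1] r r1 r2; rewrite /= !addrK !normrM (ger0_norm s0).
  by split; [apply: le_lt_trans r1|apply: le_lt_trans r2]; exact: ler_piMl.
have vE : v + p = (v.1 + p.1, v.2 + p.2) by case: v p {v11 v12 v13 v21 v22 v23 Bv Bp fx fy Bd} => ? ? [].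
have Bvp : B (v + p).
  by rewrite vE; apply: Bd; rewrite /= addrK.
have cA := cont01_radint k cf Bvp; have cB := cont01_radint k cf Bp.
have cX := cont01_radint k.+1 cx Bp; have cY := cont01_radint k.+1 cy Bp.
have c1 := cont01_cst v.1; have c2 := cont01_cst v.2.
have -> : radint k f (v + p) - radint k f p -
    lin2 (radint k.+1 (dx f) p) (radint k.+1 (dy f) p) v =
  int01 (fun t => (t ^+ k * f (sc t (v + p)) - t ^+ k * f (sc t p)) -
    (v.1 * (t ^+ k.+1 * dx f (sc t p)) + v.2 * (t ^+ k.+1 * dy f (sc t p)))).
  rewrite int01B; last 2 first.
  - exact: cont01B.
  - by apply: cont01D; exact: cont01M.
  rewrite int01B// int01D; last 2 first.
  - exact: cont01M.
  - exact: cont01M.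
  by rewrite !int01Z.
apply: int01_bound.
  by apply: cont01B; [exact: cont01B|apply: cont01D; exact: cont01M].
move=> t t01; have /andP[k0 k1] := exp01 k t01; have /andP[t0 t1] := t01.
pose a := t * (v.1 * dx f (sc t p) + v.2 * dy f (sc t p)).
have -> : t ^+ k * f (sc t (v + p)) - t ^+ k * f (sc t p) -
    (v.1 * (t ^+ k.+1 * dx f (sc t p)) + v.2 * (t ^+ k.+1 * dy f (sc t p))) =
    t ^+ k * (f (sc t (v + p)) - f (sc t p) - a).
  by rewrite /a exprS; ring.
rewrite normrM (ger0_norm k0); apply: le_trans (_ : `|f (sc t (v + p)) - f (sc t p) - a| <= _).
  exact: ler_piMl.
(* This is the segment from [p] to [p + v] scaled by [t]; its velocity carries the factor [t] that
   turns the weight [k] into [k.+1]. *)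
have seg (s : R) : 0 <= s <= 1 ->
    is_derive s 1 (fun s => f (t * (s * v.1 + p.1), t * (s * v.2 + p.2)))
      (dx f (sc t (s * v.1 + p.1, s * v.2 + p.2)) * (t * v.1) +
       dy f (sc t (s * v.1 + p.1, s * v.2 + p.2)) * (t * v.2)).
  move=> s01; have lin (x y : R) : is_derive s 1 (fun s => t * (s * x + y)) (t * x).
    apply: eq_is_derive (is_deriveZ t (is_deriveD (is_derive_scale s x) (is_derive_cst y s 1))) _.
    by rewrite addr0.
  apply: PD_curve (lin _ _) (lin _ _); apply: Ck_PD cf _.
  apply: (dball_sc (p := (s * v.1 + p.1, s * v.2 + p.2))) => //.
  by apply: Bd; have [] := Bv s s01 d3 v13 v23.
have := @MVT_dist _ _ _ a (e * `|v|) 0 1 _.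
rewrite subr0 normr1 !mulr1 => /(_ (fun s => f (t * (s * v.1 + p.1), t * (s * v.2 + p.2)))
  (fun s => dx f (sc t (s * v.1 + p.1, s * v.2 + p.2)) * (t * v.1) +
       dy f (sc t (s * v.1 + p.1, s * v.2 + p.2)) * (t * v.2))).
rewrite !mul1r !mul0r !add0r vE; apply.
rewrite min_l ?max_r ?ler01// => s s01; split; first exact: seg.
have [b1 b2] := Bv s s01 _ v11 v21; have [b3 b4] := Bv s s01 _ v12 v22.
have := fx _ b1 b2 t t01; have := fy _ b3 b4 t t01.
have n1 := norm_fst_le v; have n2 := norm_snd_le v.
rewrite /a; move: (dx f (sc t (s * v.1 + p.1, s * v.2 + p.2)))
  (dy f (sc t (s * v.1 + p.1, s * v.2 + p.2))) (dx f (sc t p)) (dy f (sc t p)).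
move=> r1 r2 r3 r4 R2 R1.
have -> : r1 * (t * v.1) + r2 * (t * v.2) - t * (v.1 * r3 + v.2 * r4) =
   t * ((r1 - r3) * v.1 + (r2 - r4) * v.2) by ring.
rewrite normrM (ger0_norm t0); apply: le_trans (ler_piMl _ t1) _ => //.
apply: le_trans (ler_normD _ _) _; rewrite !normrM.
have -> : e * `|v| = e / 2 * `|v| + e / 2 * `|v| by field.
by apply: lerD; apply: ler_pM => //; exact: ltW.
Qed.

Lemma radint_C1 k f : Ck 1 B f -> Ck 1 B (radint k f).
Proof.
move=> cf; apply: (@Ck_of_PD _ 0 B _ (radint k.+1 (dx f)) (radint k.+1 (dy f))) => //.
- by move=> p Bp; exact: radint_PD.
- exact/radint_continuous/Ck_dx.
- exact/radint_continuous/Ck_dy.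
Qed.

(** Integrate the derivative of [t ^+ k.+1 * f (sc t p)] over [0, 1]: the term at 0 vanishes because
    the exponent is positive, and the term at 1 is [f p]. *)
Lemma radint_euler k f p : Ck 1 B f -> B p ->
  k.+1%:R * radint k f p + p.1 * radint k.+1 (dx f) p + p.2 * radint k.+1 (dy f) p = f p.
Proof.
move=> cf Bp.
have cA := cont01_radint k cf Bp.
have cX := cont01_radint k.+1 (Ck_dx cf) Bp; have cY := cont01_radint k.+1 (Ck_dy cf) Bp.
have c1 := cont01_cst p.1; have c2 := cont01_cst p.2; have c3 := cont01_cst (k.+1%:R : R).
rewrite /radint -!int01Z// -int01D; [|exact: cont01M|exact: cont01M].
rewrite -int01D; [|by apply: cont01D; exact: cont01M|exact: cont01M].
have D (t : R) : 0 <= t <= 1 -> is_derive t 1 (fun t => t ^+ k.+1 * f (sc t p))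
    (k.+1%:R * (t ^+ k * f (sc t p)) + p.1 * (t ^+ k.+1 * dx f (sc t p)) +
     p.2 * (t ^+ k.+1 * dy f (sc t p))).
  move=> t01.
  have D1 : is_derive t 1 (fun s => s ^+ k.+1) (k.+1%:R * t ^+ k).
    apply: DeriveDef; first exact: exprn_derivable.
    by rewrite exp_derive /GRing.scale/= mulr1.
  have D2 : is_derive t 1 (fun s => f (sc s p)) (dx f (sc t p) * p.1 + dy f (sc t p) * p.2).
    apply: PD_curve (is_derive_scale t _) (is_derive_scale t _).
    by apply: Ck_PD cf _; exact: dball_sc.
  apply: eq_is_derive (is_deriveM D1 D2) _.
  by rewrite /GRing.scale/= exprS; ring.
rewrite (int01_FTC _ D); last by do !apply: cont01D; exact: cont01M.
rewrite expr1n expr0n/= mul0r subr0 mul1r; congr f.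
by rewrite /sc !mul1r; case: (p).
Qed.

Definition potential (P Q : plane -> R) p := p.1 * radint 0 P p + p.2 * radint 0 Q p.

(** The Poincare lemma: closedness turns the cross term [radint 1 (dx Q) p] into
    [radint 1 (dy P) p], and Euler's identity with [k = 0] concludes. Closedness is asked along the
    radius of [p] only, since for the forms below it holds on [disk] and may fail elsewhere in the
    ball. *)
Lemma potential_PD P Q p : Ck 1 B P -> Ck 1 B Q -> B p ->
  (forall t : R, 0 <= t <= 1 -> dx Q (sc t p) = dy P (sc t p)) ->
  PD (potential P Q) p (P p) (Q p).
Proof.
move=> cP cQ Bp QP.
have E : radint 1 (dx Q) p = radint 1 (dy P) p.
  by apply: eq_int01 => t t01; rewrite QP.
apply: PD_eq (PD_D (PD_M (PD_fst p) (radint_PD 0 cP Bp))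
  (PD_M (PD_snd p) (radint_PD 0 cQ Bp))) _ _.
- have := radint_euler 0 cP Bp; rewrite E.
  move: (radint 0 P p) (radint 1 (dx P) p) (radint 0 Q p) (radint 1 (dy P) p).
  by move=> r1 r2 r3 r4 <-; ring.
- have := radint_euler 0 cQ Bp; rewrite E.
  move: (radint 0 P p) (radint 1 (dy Q) p) (radint 0 Q p) (radint 1 (dy P) p).
  by move=> r1 r2 r3 r4 <-; ring.
Qed.

Lemma potential_C1 P Q : Ck 1 B P -> Ck 1 B Q -> Ck 1 B (potential P Q).
Proof.
move=> cP cQ.
exact: (Ck_D oB (Ck_M oB (Ck_fst 1 oB) (radint_C1 0 cP))
  (Ck_M oB (Ck_snd 1 oB) (radint_C1 0 cQ))).
Qed.

End OnBall.
End Radial.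
Arguments open_dball {R} rho _ _.

(** * Integration over the disk *)

Section DiskIntegral.
Context {R : realType}.
Notation plane := (R * R)%type.
Notation mu := (@lebesgue_measure R).
Notation D := (@disk R).
Implicit Types (f g : plane -> R) (p q : plane).

(** The sigma-algebra on the plane is the product one, so an open set is exhibited as a countable
    union of boxes: those with rational corners that it contains. *)
Lemma plane_open_measurable (W : set plane) : open W -> measurable W.
Proof.
move=> oW.
pose box (q : rat * rat * rat * rat) : set plane :=
  `]ratr q.1.1.1, ratr q.1.1.2[ `*` `]ratr q.1.2, ratr q.2[.
have -> : W = \bigcup_q (if `[< box q `<=` W >] then box q else set0).
  apply/seteqP; split => [p Wp|p [q _]]; last first.
    by case: ifPn => // /asboolP; exact.
  have [d d0 Wd] := open_box oW Wp.
  have l (x : R) : x - d < x by lra.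
  have r (x : R) : x < x + d by lra.
  have [a] := rat_in_itvoo (l p.1); have [b] := rat_in_itvoo (r p.1).
  have [c] := rat_in_itvoo (l p.2); have [e] := rat_in_itvoo (r p.2).
  rewrite !in_itv/= => /andP[e1 e2] /andP[c1 c2] /andP[b1 b2] /andP[a1 a2].
  exists (a, b, c, e) => //.
  case: ifPn => [_|/asboolP]; first by split; rewrite /= in_itv/= ?a2 ?c2.
  case=> q [] /=; rewrite !in_itv/= => /andP[q1 q2] /andP[q3 q4].
  by apply: Wd; rewrite ltr_norml; apply/andP; split; lra.
apply: countable_bigcupT_measurable => [|q]; first exact: countableP.
by case: ifPn => // _; apply: measurableX; exact: measurable_itv.
Qed.

Lemma disk_measurable : measurable D.
Proof.
rewrite -[D]setCK; apply: measurableC; apply: plane_open_measurable.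
have -> : ~` D = nsq @^-1` [set r | 1 < r].
  apply/seteqP; split => p; rewrite /disk /nsq/=; first by move/negP; rewrite -ltNge.
  by rewrite ltNge => /negP.
by apply: open_comp => // p _; exact: nsq_continuous.
Qed.

Lemma disk_coord p : D p -> -1 <= p.1 <= 1 /\ -1 <= p.2 <= 1.
Proof. by rewrite /disk/= => Dp; split; apply/andP; split; nra. Qed.

Lemma disk_compact : compact D.
Proof.
have sub : D `<=` `[-1, 1] `*` `[-1, 1].
  by move=> p /disk_coord[? ?]; split; rewrite /= in_itv.
apply: subclosed_compact sub; last by apply: compact_setX; exact: segment_compact.
have -> : D = nsq @^-1` [set r | r <= 1] by [].
by apply: closed_comp => [p _|]; [exact: nsq_continuous|exact: closed_le].
Qed.

Definition contD f := forall p, D p -> {for p, continuous f}.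

(** [f] may be discontinuous away from the disk, so preimages of open intervals need not be open. On
    the disk each coincides with its interior, because [contD] is continuity as a function on the
    plane. *)
Lemma contD_measurable f : contD f -> measurable_fun D f.
Proof.
move=> cf; apply: (measurability _ (measurable_realfun.RGenOpens.measurableE R)).
move=> _ [_ [a [b ->] <-]].
have -> : D `&` f @^-1` `]a, b[ = D `&` (f @^-1` `]a, b[)^°.
  apply/seteqP; split=> p [Dp fp]; split => //; last exact: interior_subset fp.
  by apply: (cf p Dp); apply: open_nbhs_nbhs; split => //; exact: interval_open.
apply: measurableI; first exact: disk_measurable.
by apply: plane_open_measurable; exact: open_interior.
Qed.

Lemma contD_bounded f : contD f -> exists2 M : R, 0 < M & forall p, D p -> `|f p| <= M.
Proof.
move=> cf; have D0 : D !=set0.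
  by exists (0, 0); rewrite /disk/= !expr0n/= addr0 ler01.
have [|c Dc Mc] := @compact_EVT_max _ _ (fun p => `|f p|) D D0 disk_compact.
  apply: continuous_in_subspaceT => p; rewrite inE => Dp.
  by apply: cvg_norm; exact: cf.
exists (`|f c| + 1); first by rewrite ltr_wpDl.
by move=> p Dp; apply: le_trans (Mc p _) _; rewrite ?inE// lerDl.
Qed.

Local Notation mu2 := ((@lebesgue_measure R) \x (@lebesgue_measure R))%E.

Lemma disk_finite : (mu2 D < +oo)%E.
Proof.
have sub : D `<=` `[-1, 1] `*` `[-1, 1].
  by move=> p /disk_coord[? ?]; split; rewrite /= in_itv.
have mB : measurable (`[(-1)%R, 1%R] `*` `[(-1)%R, 1%R] : set plane).
  by apply: measurableX; exact: measurable_itv.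
have L : (mu2 D <= mu2 (`[(-1)%R, 1%R] `*` `[(-1)%R, 1%R]))%E.
  by apply: le_measure => //; rewrite inE//; exact: disk_measurable.
apply: le_lt_trans L _.
rewrite [X in (X < _)%E](_ : _ = (mu `[(-1)%R, 1%R] * mu `[(-1)%R, 1%R])%E); last first.
  by apply: product_measure1E; exact: measurable_itv.
by rewrite /= !lebesgue_measure_itv/=; case: ifP => _; rewrite ?mule0// -EFinM ltry.
Qed.

Lemma contD_integrable f : contD f -> mu2.-integrable D (EFin \o f).
Proof.
move=> cf; apply: measurable_bounded_integrable.
- exact: disk_measurable.
- exact: disk_finite.
- exact: contD_measurable.
have [M M0 fM] := contD_bounded cf.
exists M; split; first exact: num_real.
by move=> y My p Dp; apply: le_trans (fM p Dp) (ltW My).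
Qed.

Definition intD f : R := Rintegral mu2 D f.

Lemma intDD f g : contD f -> contD g -> intD (fun p => f p + g p) = intD f + intD g.
Proof.
by move=> cf cg; rewrite /intD RintegralD//; [exact: disk_measurable|exact: contD_integrable..].
Qed.

Lemma intDB f g : contD f -> contD g -> intD (fun p => f p - g p) = intD f - intD g.
Proof.
by move=> cf cg; rewrite /intD RintegralB//; [exact: disk_measurable|exact: contD_integrable..].
Qed.

Lemma intDZ c f : contD f -> intD (fun p => c * f p) = c * intD f.
Proof.
by move=> cf; rewrite /intD RintegralZl//; [exact: disk_measurable|exact: contD_integrable].
Qed.

Lemma eq_intD f g : (forall p, D p -> f p = g p) -> intD f = intD g.
Proof. by move=> fg; apply: eq_Rintegral => p; rewrite inE => /fg. Qed.

Lemma intD_bound f c : contD f -> (forall p, D p -> `|f p| <= c) ->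
  `|intD f| <= c * fine (mu2 D).
Proof.
move=> cf fc; have If := contD_integrable cf.
rewrite -(@Rintegral_cst _ _ _ mu2 D disk_measurable c).
apply: le_trans (le_normr_Rintegral _ If) _; first exact: disk_measurable.
apply: le_Rintegral; first exact: disk_measurable.
- by apply: (@contD_integrable (fun p => `|f p|)) => p Dp; apply: cvg_norm; exact: cf.
- by apply: (@contD_integrable (fun=> c)) => p _; exact: cvg_cst.
- by move=> p; exact: fc.
Qed.

(** Half the length of the horizontal chord of the disk at height [y]. *)
Definition hchord (y : R) := Num.sqrt (1 - y ^+ 2).

Lemma disk_slice (x y : R) : -1 <= y <= 1 ->
  D (x, y) <-> - hchord y <= x <= hchord y.
Proof.
move=> /andP[y1 y2]; rewrite /disk/= /hchord.
have h0 : 0 <= 1 - y ^+ 2 by nra.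
rewrite -ler_norml -sqrtr_sqr ler_sqrt//; split; lra.
Qed.

Lemma Rintegral_FTC (phi F : R -> R) a b : a <= b ->
  (forall t : R, a <= t <= b -> {for t, continuous phi}) ->
  (forall t : R, a <= t <= b -> is_derive t 1 F (phi t)) ->
  (\int[mu]_(t in `[a, b]) (phi t)%:E)%E = (F b - F a)%:E.
Proof.
rewrite le_eqVlt => /predU1P[<- _ _|ab cp Fp].
  by rewrite set_itv1 integral_set1 subrr.
have cF (t : R) : a <= t <= b -> {for t, continuous F}.
  by move=> /Fp; exact: is_derive_continuous.
rewrite (@continuous_FTC2 _ phi F)//.
- by apply: continuous_in_subspaceT => t; rewrite inE/= in_itv/=; exact: cp.
- split.
  + by move=> t; rewrite in_itv/= => /andP[/ltW t0 /ltW t1]; have [|] := Fp t _; rewrite ?t0 ?t1.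
  + by apply: cvg_at_right_filter; apply: cF; rewrite lexx ltW.
  + by apply: cvg_at_left_filter; apply: cF; rewrite lexx ltW.
- move=> t; rewrite in_itv/= => /andP[/ltW t0 /ltW t1]; rewrite derive1E.
  by have [|] := Fp t _; rewrite ?t0 ?t1.
Qed.

Lemma restrict_integrable f : contD f ->
  mu2.-integrable setT ((EFin \o f) \_ D).
Proof.
move=> cf; rewrite -integrable_mkcond; first exact: contD_integrable.
exact: disk_measurable.
Qed.

Lemma intD_iter21 f : contD f ->
  intD f = fine (\int[mu]_y \int[mu]_x ((EFin \o f) \_ D) (x, y))%E.
Proof.
move=> cf; rewrite /intD /Rintegral integral_mkcond; congr fine.
by rewrite -[LHS](integral21_prod_meas1 (restrict_integrable cf)).
Qed.

Lemma intD_iter12 f : contD f ->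
  intD f = fine (\int[mu]_x \int[mu]_y ((EFin \o f) \_ D) (x, y))%E.
Proof.
move=> cf; rewrite /intD /Rintegral integral_mkcond; congr fine.
by rewrite -[LHS](integral12_prod_meas1 (restrict_integrable cf)).
Qed.

Definition swp p : plane := (p.2, p.1).

Lemma disk_swp p : D (swp p) <-> D p.
Proof. by rewrite /disk/= addrC. Qed.

Lemma contD_swp f : contD f -> contD (fun p => f (swp p)).
Proof.
move=> cf p Dp; apply: continuous_plane.
- by apply: cf; exact/disk_swp.
- exact: continuous_snd.
- exact: continuous_fst.
Qed.

Lemma intD_swp f : contD f -> intD (fun p => f (swp p)) = intD f.
Proof.
move=> cf; rewrite (intD_iter21 (contD_swp cf)) (intD_iter12 cf); congr fine.
apply: eq_integral => y _; apply: eq_integral => x _.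
rewrite !patchE; suff -> : ((x, y) \in D) = ((y, x) \in D) by [].
by apply/idP/idP; rewrite !inE => /disk_swp.
Qed.

(** Fubini with the horizontal integral inside, then the fundamental theorem of calculus on each
    chord. *)
Lemma intD_slices u v : (forall p, D p -> is_derive p.1 1 (fun s => u (s, p.2)) (v p)) ->
  contD v ->
  intD v = fine (\int[mu]_(y in `[(-1)%R, 1%R]) (u (hchord y, y) - u (- hchord y, y))%:E)%E.
Proof.
move=> uv cv; rewrite (intD_iter21 cv) [in RHS]integral_mkcond; congr fine.
apply: eq_integral => y _; rewrite [RHS]patchE.
case: ifPn => [|/negP y1]; last first.
  rewrite integral0_eq// => x _; rewrite patchE ifN//.
  apply/negP; rewrite inE => /disk_coord[_ ?]; apply: y1.
  by rewrite inE/= in_itv.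
rewrite inE/= in_itv/= => y1.
have h0 : 0 <= hchord y by exact: sqrtr_ge0.
have cs (x : R) : - hchord y <= x <= hchord y -> {for x, continuous (fun s => v (s, y))}.
  move=> /(disk_slice x y1) Dx; apply: (@continuous_plane _ _ v (fun s => (s, y))).
  - exact: cv.
  - exact: cvg_id.
  - exact: cvg_cst.
have ds (x : R) : - hchord y <= x <= hchord y -> is_derive x 1 (fun s => u (s, y)) (v (x, y)).
  by move=> /(disk_slice x y1) Dx; exact: (uv (x, y)).
have hh : - hchord y <= hchord y by lra.
rewrite -(Rintegral_FTC hh cs ds) [RHS]integral_mkcond; apply: eq_integral => x _.
rewrite !patchE; suff -> : ((x, y) \in D) = (x \in `[- hchord y, hchord y]%classic) by [].
by apply/idP/idP; rewrite !inE/= in_itv/= => /(disk_slice x y1).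
Qed.

End DiskIntegral.

(** * Green's formula *)

Section Antiderivative.
Context {R : realType}.
Notation mu := (@lebesgue_measure R).

Lemma antiderivative_eq (E F k : R -> R) (x y : R) :
  (forall s, Num.min x y <= s <= Num.max x y -> is_derive s 1 E (k s)) ->
  (forall s, Num.min x y <= s <= Num.max x y -> is_derive s 1 F (k s)) ->
  E y - E x = F y - F x.
Proof.
move=> Ek Fk; suff : E x - F x = E y - F y by lra.
apply: (@is_derive0_eq _ (fun s => E s - F s)) => s sxy.
by apply: eq_is_derive (is_deriveB (Ek s sxy) (Fk s sxy)) _; rewrite subrr.
Qed.

Lemma near_is_derive (E F : R -> R) (x l : R) : (\forall s \near x, E s = F s) ->
  is_derive x 1 E l -> is_derive x 1 F l.
Proof. by move=> EF; apply: near_eq_is_derive. Qed.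

(** The fundamental theorem starts from a fixed left end, which has to move left as [|x|] grows;
    subtracting the value at 0 glues the resulting local antiderivatives. *)
Lemma antiderivative (k : R -> R) : continuous k ->
  exists E : R -> R, forall t : R, is_derive t 1 E (k t).
Proof.
move=> ck; pose G (N x : R) := Rintegral mu `[- N, x] k.
have Gk (N x : R) : - N < x -> is_derive x 1 (G N) (k x).
  move=> Nx; have xx : x < x + 1 by rewrite ltrDl.
  have kI : mu.-integrable `[- N, x + 1] (EFin \o k).
    apply: continuous_compact_integrable; first exact: segment_compact.
    exact: continuous_subspaceT.
  have [dG DG] := continuous_FTC1_closed xx kI Nx (ck x).
  by apply: DeriveDef; [exact: dG|rewrite -derive1E].
exists (fun x => G (`|x| + 1) x - G (`|x| + 1) 0) => x.
(* For [y] at distance less than 1 from [x], the base point [- N] lies to the left of the moving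
   one, [- (|y| + 1)]. *)
pose N := `|x| + 2.
have GN : is_derive x 1 (fun y => G N y - G N 0) (k x).
  have Nx : - N < x by rewrite /N; have := ler_norm (- x); rewrite normrN; lra.
  by apply: eq_is_derive (is_deriveB (Gk N x Nx) (is_derive_cst _ x 1)) _; rewrite subr0.
apply: near_is_derive GN; apply/nbhs_ballP; exists 1 => //= y xy.
have yN : - N < - (`|y| + 1).
  rewrite /N; have := lerB_normD y (x - y); have := xy; rewrite /ball/=.
  by rewrite distrC; have := ler_normD x (y - x); rewrite addrC subrK distrC; lra.
apply: (@antiderivative_eq _ _ k) => s sy; apply: Gk; move: sy; last first.
  all: have := ler_norm (- y); rewrite normrN; have := normr_ge0 y;
    case: (leP 0 y) => _ ? ? /andP[? _]; lra.
Qed.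

End Antiderivative.

Section Green.
Context {R : realType}.
Notation plane := (R * R)%type.
Notation mu := (@lebesgue_measure R).
Notation D := (@disk R).
Notation pi := (@pi R).
Implicit Types (f g A B : plane -> R) (p q : plane) (E : R -> R).

Definition circ (t : R) : plane := (cos t, sin t).

Lemma disk_circ t : D (circ t).
Proof. by rewrite /disk/= cos2Dsin2. Qed.

(** [E] shifted by a period has the same derivative as [E], so the two differ by a constant. *)
Lemma is_derive_periodic E (k : R -> R) a :
  (forall t : R, is_derive t 1 E (k t)) -> (forall t, k (t + pi *+ 2) = k t) ->
  E (a + pi *+ 2) - E a = E (pi *+ 2) - E 0.
Proof.
move=> Ek kp; have S (t : R) : is_derive t 1 (fun s => E (s + pi *+ 2)) (k t).
  have D1 : is_derive t 1 (fun s => s + pi *+ 2) 1.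
    by apply: eq_is_derive (is_deriveD (is_derive_id t 1) (is_derive_cst _ t 1)) _; rewrite addr0.
  have := @is_derive1_comp _ E (fun s => s + pi *+ 2) t _ _ (Ek _) D1.
  by move=> /eq_is_derive; apply; rewrite kp mulr1.
have := @antiderivative_eq _ _ _ k 0 a (fun s _ => S s) (fun s _ => Ek s).
rewrite add0r; lra.
Qed.

Lemma hchord_continuous : continuous (@hchord R).
Proof.
move=> y.
have c1 : {for y, continuous (fun y : R => 1 - y ^+ 2)}.
  by apply: cvgB; [exact: cvg_cst|exact: exprn_continuous].
exact: continuous_comp c1 (@sqrt_continuous R _).
Qed.

Lemma Ck_contD U f : D `<=` U -> Ck 0 U f -> contD f.
Proof. by move=> DU cf p Dp; apply: cf; exact: DU. Qed.

(** At height [y = sin t], with [t] in [-pi/2, pi/2], the ends of the chord are [circ t] and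
    [circ (pi - t)]. The substitution replaces [hchord], which is not differentiable at the poles,
    by [cos t]. *)
Lemma green_x U f E : open U -> D `<=` U -> Ck 1 U f ->
  (forall t : R, is_derive t 1 E (f (circ t) * cos t)) ->
  intD (dx f) = E (pi *+ 2) - E 0.
Proof.
move=> oU DU cf Ef.
have cv : contD (dx f) by apply: Ck_contD DU _; exact: Ck_dx.
have fx p : D p -> is_derive p.1 1 (fun s => f (s, p.2)) (dx f p).
  case: p => x y Dp; apply: (@PD_x _ f x y _ (dy f (x, y))).
  by apply: Ck_PD cf _; exact: DU.
rewrite (intD_slices fx cv).
pose w (y : R) := f (hchord y, y) - f (- hchord y, y).
have cw (y : R) : -1 <= y <= 1 -> {for y, continuous w}.
  move=> y1; have h0 : 0 <= hchord y by exact: sqrtr_ge0.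
  have c1 : {for y, continuous (fun y => f (hchord y, y))}.
    apply: (@continuous_plane _ _ f (fun y => (hchord y, y))).
    - by apply: (Ck_continuous cf); apply/DU/(disk_slice _ y1); lra.
    - exact: hchord_continuous.
    - exact: cvg_id.
  have c2 : {for y, continuous (fun y => f (- hchord y, y))}.
    apply: (@continuous_plane _ _ f (fun y => (- hchord y, y))).
    - by apply: (Ck_continuous cf); apply/DU/(disk_slice _ y1); lra.
    - by apply: cvgN; exact: hchord_continuous.
    - exact: cvg_id.
  exact: cvgB c1 c2.
have sinL : sin (- (pi / 2)) = -1 :> R by rewrite sinN sin_pihalf.
have sinR : sin (pi / 2) = 1 :> R by rewrite sin_pihalf.
have pi0 := @pi_gt0 R.
have dsin : derive1 (@sin R) = @cos R.
  by apply/funext => t; rewrite derive1E; apply: derive_val.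
have := @integration_by_substitution_increasing R (@sin R) w (- (pi / 2)) (pi / 2).
rewrite sinL sinR dsin => sub.
rewrite -/w [X in fine X]sub; last first.
- by apply: continuous_in_subspaceT => y; rewrite inE/= in_itv/=; exact: cw.
- split.
  + by move=> t _; exact: ex_derive.
  + by apply: cvg_at_right_filter; exact: continuous_sin.
  + by apply: cvg_at_left_filter; exact: continuous_sin.
- by apply/cvg_ex; exists (cos (pi / 2)); apply: cvg_at_left_filter; exact: continuous_cos.
- by apply/cvg_ex; exists (cos (- (pi / 2))); apply: cvg_at_right_filter; exact: continuous_cos.
- by move=> t _; exact: continuous_cos.
- by move=> x y xI yI; rewrite ltr_sin.
- by lra.
have hs (t : R) : - (pi / 2) <= t <= pi / 2 -> hchord (sin t) = cos t.
  by move=> t2; rewrite /hchord -cos2sin2 sqrtr_sqr ger0_norm// cos_ge0_pihalf.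
have FD (t : R) : - (pi / 2) <= t <= pi / 2 ->
    is_derive t 1 (fun t => E t - E (pi - t)) (w (sin t) * cos t).
  move=> t2; have D1 : is_derive t 1 (fun s => pi - s) (-1).
    by apply: eq_is_derive (is_deriveB (is_derive_cst _ t 1) (is_derive_id t 1)) _; rewrite sub0r.
  have D2 := @is_derive1_comp _ E (fun s => pi - s) t _ _ (Ef _) D1.
  apply: eq_is_derive (is_deriveB (Ef t) D2) _.
  have cE : cos (pi - t) = - cos t by rewrite addrC cosDpi cosN.
  have sE : sin (pi - t) = sin t by rewrite addrC sinDpi sinN opprK.
  by rewrite /w (hs t t2) /circ cE sE; ring.
have cwt (t : R) : - (pi / 2) <= t <= pi / 2 -> {for t, continuous (fun t => w (sin t) * cos t)}.
  move=> t2; apply: cvgM; last exact: continuous_cos.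
  apply: (@continuous_comp _ _ _ (@sin R) w); first exact: continuous_sin.
  by apply: cw; rewrite sin_geN1 sin_le1.
have pp : - (pi / 2) <= pi / 2 by lra.
rewrite [X in fine X](Rintegral_FTC pp cwt FD)/=.
(* The two half circles together run from -pi/2 to 3 pi/2, and the increment over a period does not
   depend on where it starts. *)
have per := @is_derive_periodic E _ (- (pi / 2)) Ef _.
rewrite -per; last first.
  by move=> t; rewrite /circ cosD2pi sinD2pi.
have -> : pi - pi / 2 = pi / 2 by field.
have -> : pi - - (pi / 2) = - (pi / 2) + pi *+ 2 by field.
ring.
Qed.

Lemma circ_swp t : circ (pi / 2 - t) = swp (circ t).
Proof. by rewrite /circ /swp/= addrC cosDpihalf sinDpihalf sinN cosN opprK. Qed.

Lemma PD_swp f p : PD f (swp p) (dx f (swp p)) (dy f (swp p)) ->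
  PD (fun q => f (swp q)) p (dy f (swp p)) (dx f (swp p)).
Proof.
move=> fp; apply: PD_eq (PD_comp fp (PD_snd p) (PD_fst p)) _ _; ring.
Qed.

(** Exchanging the coordinates reduces this to [green_x]. By [circ_swp] the exchange reverses the
    circle, whence the antiderivative [- E (pi / 2 - s)]. *)
Lemma green_y U f E : open U -> D `<=` U -> Ck 1 U f ->
  (forall t : R, is_derive t 1 E (f (circ t) * sin t)) ->
  intD (dy f) = E (pi *+ 2) - E 0.
Proof.
move=> oU DU cf Ef.
pose V := [set p | U (swp p)].
have oV : open V.
  apply: (@open_comp _ _ (fun p : plane => swp p)) => // p _.
  exact: swap_continuous.
have DV : D `<=` V by move=> p Dp; apply: DU; exact/disk_swp.
have cs : Ck 1 V (fun p => f (swp p)).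
  by apply: Ck_comp cf _ _ => //; [exact: Ck_snd|exact: Ck_fst].
have dE p : D p -> dx (fun q => f (swp q)) p = dy f (swp p).
  move=> Dp; apply: PD_dx; apply: PD_swp; apply: Ck_PD cf _; exact: DV.
have cv : contD (dy f) by apply: Ck_contD DU _; exact: Ck_dy.
rewrite -(intD_swp cv) -(eq_intD dE).
have EN (t : R) : is_derive t 1 (fun s => - E (pi / 2 - s)) (f (swp (circ t)) * cos t).
  have D1 : is_derive t 1 (fun s => pi / 2 - s) (-1).
    by apply: eq_is_derive (is_deriveB (is_derive_cst _ t 1) (is_derive_id t 1)) _; rewrite sub0r.
  have D2 := @is_derive1_comp _ E (fun s => pi / 2 - s) t _ _ (Ef _) D1.
  apply: eq_is_derive (is_deriveN D2) _.
  have -> : sin (pi / 2 - t) = cos t by rewrite addrC sinDpihalf cosN.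
  by rewrite circ_swp; ring.
rewrite (green_x oV DV cs EN).
have per : E (pi / 2 - pi *+ 2 + pi *+ 2) - E (pi / 2 - pi *+ 2) = E (pi *+ 2) - E 0.
  by apply: is_derive_periodic Ef _ => t; rewrite /circ cosD2pi sinD2pi.
rewrite -per subrK subr0; ring.
Qed.

Lemma continuous_circ U f : D `<=` U -> Ck 0 U f -> continuous (fun t => f (circ t)).
Proof.
move=> DU cf t; apply: (@continuous_plane _ _ f circ).
- by apply: cf; apply: DU; exact: disk_circ.
- exact: continuous_cos.
- exact: continuous_sin.
Qed.

Lemma green U A B E : open U -> D `<=` U -> Ck 1 U A -> Ck 1 U B ->
  (forall t : R, is_derive t 1 E (B (circ t) * cos t - A (circ t) * sin t)) ->
  intD (fun p => dx B p - dy A p) = E (pi *+ 2) - E 0.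
Proof.
move=> oU DU cA cB EAB.
have [EB EBE] : exists F : R -> R, forall t : R, is_derive t 1 F (B (circ t) * cos t).
  apply: antiderivative => t; apply: cvgM; last exact: continuous_cos.
  by apply: (continuous_circ DU); exact: CkS.
have [EA EAE] : exists F : R -> R, forall t : R, is_derive t 1 F (A (circ t) * sin t).
  apply: antiderivative => t; apply: cvgM; last exact: continuous_sin.
  by apply: (continuous_circ DU); exact: CkS.
rewrite intDB; [|by apply: Ck_contD DU _; exact: Ck_dx|by apply: Ck_contD DU _; exact: Ck_dy].
rewrite (green_x oU DU cB EBE) (green_y oU DU cA EAE).
have := @antiderivative_eq _ _ _ _ 0 (pi *+ 2) (fun s _ => EAB s)
  (fun s _ => is_deriveB (EBE s) (EAE s)).
by move=> ->; rewrite !fctE; ring.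
Qed.

End Green.

(** * Area-preserving maps of the disk and their generating functions *)

Section Symplectic.
Context {R : realType}.
Notation plane := (R * R)%type.
Notation D := (@disk R).
Notation pi := (@pi R).
Implicit Types (f : plane -> R) (p q : plane) (g h : plane -> plane)
  (U V W : set plane).

(** Radial integrals require a star-shaped domain, which the neighbourhood attached to a map need
    not be. If the compact set [K] is nonempty, the least value of [nsq] on it exceeds 1 and serves
    as [rho], a bound on the squared radius. *)
Lemma dball_in U : open U -> D `<=` U -> exists2 rho : R, 1 < rho & dball rho `<=` U.
Proof.
move=> oU DU; pose K := [set p | nsq p <= 4] `&` ~` U.
have [K0|/set0P K0] := eqVneq K set0.
  exists 4; first lra.
  move=> p Bp; apply: contrapT => nUp.
  by have : K p by [split => //; exact: ltW]; rewrite K0.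
have cK : compact K.
  have sub : K `<=` `[-2, 2] `*` `[-2, 2].
    by move=> p [/= + _]; rewrite /nsq => ?; split; rewrite /= in_itv/=;
      apply/andP; split; nra.
  apply: subclosed_compact sub; last by apply: compact_setX; exact: segment_compact.
  apply: closedI; last exact: open_closedC.
  have -> : [set p | nsq p <= 4] = nsq @^-1` [set r : R | r <= 4] by [].
  by apply: closed_comp => [p _|]; [exact: nsq_continuous|exact: closed_le].
have [|c Kc cmin] := @compact_EVT_min _ _ (@nsq R) K K0 cK.
  by apply: continuous_subspaceT; exact: nsq_continuous.
move: Kc; rewrite inE => -[/= c4 nUc].
exists (nsq c); first by rewrite ltNge; apply/negP => Dc; apply/nUc/DU.
move=> p Bp; apply: contrapT => nUp.
have /cmin : p \in K by rewrite inE; split => //=; apply: le_trans (ltW Bp) c4.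
by rewrite leNgt Bp.
Qed.

Lemma open_preimage_map U W h : open U -> open W ->
  (forall p, U p -> {for p, continuous (fun q => (h q).1)}) ->
  (forall p, U p -> {for p, continuous (fun q => (h q).2)}) ->
  open [set p | U p /\ W (h p)].
Proof.
move=> oU oW c1 c2; rewrite openE => p [Up Wp].
have [d d0 Wd] := open_box oW Wp.
have /cvgrPdist_lt/(_ _ d0) n1 := c1 p Up.
have /cvgrPdist_lt/(_ _ d0) n2 := c2 p Up.
apply: filterS3 (open_nbhs_nbhs (conj oU Up)) n1 n2 => q Uq q1 q2.
by split => //; apply: Wd; rewrite distrC.
Qed.

(** Two derivatives are what d(h^*eta) = h^*omega consumes. The open set depends on the map and may
    shrink under composition. *)
Definition regular U h := [/\ open U, D `<=` U,
  Ck 2 U (fun p => (h p).1) & Ck 2 U (fun p => (h p).2)].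

Lemma regular_PD U h p : regular U h -> U p ->
  PD (fun p => (h p).1) p (dx (fun p => (h p).1) p) (dy (fun p => (h p).1) p) /\
  PD (fun p => (h p).2) p (dx (fun p => (h p).2) p) (dy (fun p => (h p).2) p).
Proof. by move=> [_ _ c1 c2] Up; split; [exact: Ck_PD c1 Up|exact: Ck_PD c2 Up]. Qed.

Lemma regular_preimage U W h : regular U h -> (forall p, D p -> D (h p)) ->
  open W -> D `<=` W -> exists V, [/\ open V, D `<=` V, V `<=` U &
    forall p, V p -> W (h p)].
Proof.
move=> [oU DU c1 c2] hD oW DW; exists [set p | U p /\ W (h p)]; split.
- exact: (open_preimage_map oU oW (fun p Up => Ck_continuous c1 Up)
    (fun p Up => Ck_continuous c2 Up)).
- by move=> p Dp; split; [exact: DU|exact/DW/hD].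
- by move=> p [].
- by move=> p [].
Qed.

Lemma regular_comp U W g h : regular U h -> regular W g -> (forall p, D p -> D (h p)) ->
  exists V, regular V (g \o h) /\ V `<=` U /\ (forall p, V p -> W (h p)).
Proof.
move=> rh [oW DW g1 g2] hD; have [V [oV DV VU VW]] := regular_preimage rh hD oW DW.
have [_ _ c1 c2] := rh; exists V; split=> //; split => //=.
- by apply: Ck_comp VW g1 _ _ => //; [exact: Ck_sub VU c1|exact: Ck_sub VU c2].
- by apply: Ck_comp VW g2 _ _ => //; [exact: Ck_sub VU c1|exact: Ck_sub VU c2].
Qed.

Lemma comp_PD U W g h p : regular U h -> regular W g -> U p -> W (h p) ->
  [/\ PD (fun q => (g (h q)).1) p
    (dx (fun q => (g q).1) (h p) * dx (fun q => (h q).1) p +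
     dy (fun q => (g q).1) (h p) * dx (fun q => (h q).2) p)
    (dx (fun q => (g q).1) (h p) * dy (fun q => (h q).1) p +
     dy (fun q => (g q).1) (h p) * dy (fun q => (h q).2) p) &
   PD (fun q => (g (h q)).2) p
    (dx (fun q => (g q).2) (h p) * dx (fun q => (h q).1) p +
     dy (fun q => (g q).2) (h p) * dx (fun q => (h q).2) p)
    (dx (fun q => (g q).2) (h p) * dy (fun q => (h q).1) p +
     dy (fun q => (g q).2) (h p) * dy (fun q => (h q).2) p)].
Proof.
move=> rh rg Up Wp; have [h1 h2] := regular_PD rh Up; have [g1 g2] := regular_PD rg Wp.
by split; [exact: (PD_comp g1 h1 h2)|exact: (PD_comp g2 h1 h2)].
Qed.

Lemma jac_comp U W g h p : regular U h -> regular W g -> U p -> W (h p) ->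
  jac (g \o h) p = jac g (h p) * jac h p.
Proof.
move=> rh rg Up Wp; have [c1 c2] := comp_PD rh rg Up Wp.
rewrite /jac /= (PD_dx c1) (PD_dy c1) (PD_dx c2) (PD_dy c2).
move: (dx _ (h p)) (dx _ (h p)) (dy _ (h p)) (dy _ (h p)) (dx _ p) (dx _ p) (dy _ p) (dy _ p).
move=> r1 r2 r3 r4 r5 r6 r7 r8; ring.
Qed.

Lemma pull_comp U W g h p : regular U h -> regular W g -> U p -> W (h p) ->
  pullP (g \o h) p = pullP g (h p) * dx (fun q => (h q).1) p
    + pullQ g (h p) * dx (fun q => (h q).2) p /\
  pullQ (g \o h) p = pullP g (h p) * dy (fun q => (h q).1) p
    + pullQ g (h p) * dy (fun q => (h q).2) p.
Proof.
move=> rh rg Up Wp; have [c1 c2] := comp_PD rh rg Up Wp.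
rewrite /pullP /pullQ /= (PD_dx c1) (PD_dy c1) (PD_dx c2) (PD_dy c2).
move: (dx _ (h p)) (dx _ (h p)) (dy _ (h p)) (dy _ (h p)) (dx _ p) (dx _ p) (dy _ p) (dy _ p).
by move: (eta_a _) (eta_b _) => a b r1 r2 r3 r4 r5 r6 r7 r8; split; ring.
Qed.

Lemma eta_aE : @eta_a R = fun p => - 2^-1 * p.2.
Proof. by apply/funext => p; rewrite /eta_a; field. Qed.

Lemma eta_bE : @eta_b R = fun p => 2^-1 * p.1.
Proof. by apply/funext => p; rewrite /eta_b; field. Qed.

Lemma PD_eta_a p : PD (@eta_a R) p 0 (- 2^-1).
Proof. by rewrite eta_aE; apply: PD_eq (PD_Z _ (PD_snd p)) _ _; ring. Qed.

Lemma PD_eta_b p : PD (@eta_b R) p (2^-1) 0.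
Proof. by rewrite eta_bE; apply: PD_eq (PD_Z _ (PD_fst p)) _ _; ring. Qed.

Lemma Ck_eta_a k U : open U -> Ck k U (@eta_a R).
Proof. by move=> oU; rewrite eta_aE; apply: Ck_Z => //; exact: Ck_snd. Qed.

Lemma Ck_eta_b k U : open U -> Ck k U (@eta_b R).
Proof. by move=> oU; rewrite eta_bE; apply: Ck_Z => //; exact: Ck_fst. Qed.

Lemma pull_C1 U h : regular U h -> Ck 1 U (pullP h) /\ Ck 1 U (pullQ h).
Proof.
move=> [oU DU c1 c2]; have [a b] : Ck 1 U (fun p => eta_a (h p)) /\ Ck 1 U (fun p => eta_b (h p)).
  have d1 := CkS c1; have d2 := CkS c2; rewrite eta_aE eta_bE.
  by split; apply: Ck_Z.
split; [exact: (Ck_D oU (Ck_M oU a (Ck_dx c1)) (Ck_M oU b (Ck_dx c2)))|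
  exact: (Ck_D oU (Ck_M oU a (Ck_dy c1)) (Ck_M oU b (Ck_dy c2)))].
Qed.

Lemma pullPE h : pullP h = fun p => - 2^-1 * (h p).2 * dx (fun q => (h q).1) p +
  2^-1 * (h p).1 * dx (fun q => (h q).2) p.
Proof. by apply/funext => p; rewrite /pullP eta_aE eta_bE. Qed.

Lemma pullQE h : pullQ h = fun p => - 2^-1 * (h p).2 * dy (fun q => (h q).1) p +
  2^-1 * (h p).1 * dy (fun q => (h q).2) p.
Proof. by apply/funext => p; rewrite /pullQ eta_aE eta_bE. Qed.

(** This is d(h^*eta) = h^*omega in coordinates; the second derivatives cancel by [dxdy]. *)
Lemma pull_curl U h p : regular U h -> U p ->
  dx (pullQ h) p - dy (pullP h) p = jac h p.
Proof.
move=> rh Up; have [oU DU c1 c2] := rh; have [h1 h2] := regular_PD rh Up.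
have a := PD_Z (- 2^-1) h2; have b := PD_Z (2^-1) h1.
have Q := PD_D (PD_M a (Ck_PD (Ck_dy c1) Up)) (PD_M b (Ck_PD (Ck_dy c2) Up)).
have P := PD_D (PD_M a (Ck_PD (Ck_dx c1) Up)) (PD_M b (Ck_PD (Ck_dx c2) Up)).
rewrite pullPE pullQE (PD_dx Q) (PD_dy P) (dxdy oU c1 Up) (dxdy oU c2 Up) /jac {P Q a b}.
move: (dx (fun q => (h q).1) p) (dx (fun q => (h q).2) p)
  (dy (fun q => (h q).1) p) (dy (fun q => (h q).2) p) => r1 r2 r3 r4.
move: (dy (dx _) p) (dy (dx _) p) => r5 r6; by field.
Qed.

(* C^2 regularity and the boundary behaviour are all that is needed of G_o, and
   this class is stable under composition. *)
Definition symp2 g : Prop :=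
  [/\ exists U, regular U g, (forall p, D p -> D (g p)),
      (forall p, D p -> jac g p = 1),
      (forall p, nsq p = 1 -> nsq (g p) = 1) /\
      (forall p q, nsq p = 1 -> nsq q = 1 -> g p = g q -> p = q) &
      g (@origin R) = @origin R].

Lemma disk_nsq p : nsq p = 1 -> D p.
Proof. by rewrite /disk/= -/(nsq p) => ->. Qed.

Lemma symp2_comp g h : symp2 g -> symp2 h -> symp2 (g \o h).
Proof.
move=> [[W rg] gD gj [gc gi] go] [[U rh] hD hj [hc hi] ho]; split.
- by have [V [rV _]] := regular_comp rh rg hD; exists V.
- by move=> p /hD /gD.
- move=> p Dp; have [_ DU _ _] := rh; have [_ DW _ _] := rg.
  by rewrite (jac_comp rh rg (DU _ Dp) (DW _ (hD _ Dp))) gj ?hj ?mulr1//; exact: hD.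
- split=> [p /hc /gc //|p q p1 q1 E]; apply: hi => //.
  by apply: gi E; exact: hc.
- by rewrite /= ho go.
Qed.

Lemma regular_id : regular setT (id : plane -> plane).
Proof.
by split => //; [exact: openT|exact: (Ck_fst 2 openT)|exact: (Ck_snd 2 openT)].
Qed.

Lemma symp2_id : symp2 id.
Proof.
split => //; first by exists setT; exact: regular_id.
move=> p _; rewrite /jac (PD_dx (PD_fst p)) (PD_dy (PD_snd p)).
by rewrite (PD_dy (PD_fst p)) mulr1 mul0r subr0.
Qed.

Lemma symp2_iter g n : symp2 g -> symp2 (iter n g).
Proof.
move=> sg; elim: n => [|n IH]; first exact: symp2_id.
exact: symp2_comp.
Qed.

Lemma symp_regular g : symp g -> exists U, regular U g.
Proof.
by move=> [[U [DU [s1 s2]]] _ _ _]; exists U; split => //;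
  [case: s1|exact: smooth_on_Ck|exact: smooth_on_Ck].
Qed.

(* At an interior point sent to the circle, |h|^2 has a maximum, so the
   invertible differential of h kills the nonzero vector h. *)
Lemma symp_boundary g p : symp g -> nsq p = 1 -> nsq (g p) = 1.
Proof.
move=> sg p1; have [U rg] := symp_regular sg.
have [_ gD [h [hs hD hg gh]] gj] := sg.
have [W rh] : exists W, regular W h.
  by case: hs => W [DW [s1 s2]]; exists W; split => //;
    [case: s1|exact: smooth_on_Ck|exact: smooth_on_Ck].
have Dp := disk_nsq p1; pose q := g p; have Dq : D q by exact: gD.
apply/eqP; rewrite eq_le [X in X && _](Dq : nsq q <= 1)/= leNgt; apply/negP => q1.
have hq : h q = p by rewrite /q hg.
have [_ DU _ _] := rg; have [oW DW _ _] := rh.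
have Bq : \forall z \near q, dball 1 z.
  by apply: open_nbhs_nbhs; split => //; exact: open_dball.
have gh1 : \forall z \near q, z.1 = (g (h z)).1.
  by apply: filterS Bq => z Bz; rewrite gh//; exact: ltW.
have gh2 : \forall z \near q, z.2 = (g (h z)).2.
  by apply: filterS Bq => z Bz; rewrite gh//; exact: ltW.
have Whq : U (h q) by rewrite hq; exact: DU.
have [C1 C2] := comp_PD rh rg (DW _ Dq) Whq.
have J : jac g (h q) * jac h q = 1.
  rewrite -(jac_comp rh rg (DW _ Dq) Whq) /jac /=.
  rewrite -(dx_near gh1) -(dy_near gh1) -(dx_near gh2) -(dy_near gh2).
  rewrite (PD_dx (PD_fst q)) (PD_dy (PD_snd q)).
  by rewrite (PD_dy (PD_fst q)) mulr1 mul0r subr0.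
have oV : open (W `&` dball 1) by apply: openI => //; exact: open_dball.
have [d d0 dV] := open_box oV (conj (DW _ Dq) q1).
have N z : W z -> PD (fun z => nsq (h z)) z _ _ := fun Wz =>
  PD_comp (PD_nsq (h z)) (regular_PD rh Wz).1 (regular_PD rh Wz).2.
have crit (F dF : R -> R) (x : R) :
    (forall s : R, `|s - x| < d -> is_derive s 1 F (dF s)) ->
    (forall s : R, `|s - x| < d -> F s <= F x) -> dF x = 0.
  move=> FD Fm; have sd (s : R) : s \in `]x - d, x + d[ -> `|s - x| < d.
    by rewrite in_itv/= ltr_norml => /andP[? ?]; apply/andP; split; lra.
  have xx : x \in `]x - d, x + d[ by rewrite in_itv/=; apply/andP; split; lra.
  have F0 : is_derive x 1 F 0.
    apply: (@derive1_at_max _ F (x - d) (x + d)) => //; first lra.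
    - by move=> s /sd /FD [].
    - by move=> s /sd /Fm.
  by have [_ <-] := FD x (sd _ xx); case: F0.
have VW z : (W `&` dball 1) z -> W z by move=> [].
have hmax z : (W `&` dball 1) z -> nsq (h z) <= nsq (h q).
  by move=> [_ Bz]; rewrite hq p1; apply: hD; exact: ltW.
have qq (a : R) : `|a - a| < d by rewrite subrr normr0.
have sq : (q.1, q.2) = q by rewrite -surjective_pairing.
have Ex : 2 * (h q).1 * dx (fun z => (h z).1) q + 2 * (h q).2 * dx (fun z => (h z).2) q = 0.
  rewrite -sq; apply: (crit (fun s => nsq (h (s, q.2))) (fun s =>
    2 * (h (s, q.2)).1 * dx (fun z => (h z).1) (s, q.2) +
    2 * (h (s, q.2)).2 * dx (fun z => (h z).2) (s, q.2)) q.1) => s sd.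
  - by apply: (PD_x (f := fun z => nsq (h z))); apply: N; apply/VW/dV; [exact: sd|exact: qq].
  - by rewrite sq; apply/hmax/dV; [exact: sd|exact: qq].
have Ey : 2 * (h q).1 * dy (fun z => (h z).1) q + 2 * (h q).2 * dy (fun z => (h z).2) q = 0.
  rewrite -sq; apply: (crit (fun s => nsq (h (q.1, s))) (fun s =>
    2 * (h (q.1, s)).1 * dy (fun z => (h z).1) (q.1, s) +
    2 * (h (q.1, s)).2 * dy (fun z => (h z).2) (q.1, s)) q.2) => s sd.
  - by apply: (PD_y (f := fun z => nsq (h z))); apply: N; apply/VW/dV; [exact: qq|exact: sd].
  - by rewrite sq; apply/hmax/dV; [exact: qq|exact: sd].
have J0 : jac h q != 0.
  by apply/eqP => J0; move: J; rewrite J0 mulr0 => /esym/eqP; rewrite oner_eq0.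
move: p1 J0; rewrite -hq /nsq /jac; move: Ex Ey.
move: (dx (fun z => (h z).1) q) (dx (fun z => (h z).2) q)
  (dy (fun z => (h z).1) q) (dy (fun z => (h z).2) q) (h q).1 (h q).2.
move=> a b c e u v Ex Ey uv J0.
(* Cramer's rule: [Ex] and [Ey] say that the transposed Jacobian matrix kills [(u, v)], so the
   determinant times either coordinate vanishes. *)
have u0 : u * (a * e - c * b) = 0.
  have -> : u * (a * e - c * b) = (2 * u * a + 2 * v * b) * e / 2 - (2 * u * c + 2 * v * e) * b / 2 by field.
  by rewrite Ex Ey !mul0r subr0.
have v0 : v * (a * e - c * b) = 0.
  have -> : v * (a * e - c * b) = (2 * u * c + 2 * v * e) * a / 2 - (2 * u * a + 2 * v * b) * c / 2 by field.
  by rewrite Ex Ey !mul0r subr0.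
move/eqP : u0; rewrite mulf_eq0 (negbTE J0) orbF => /eqP u0.
move/eqP : v0; rewrite mulf_eq0 (negbTE J0) orbF => /eqP v0.
by move/eqP: uv; rewrite u0 v0 expr0n/= addr0 eq_sym oner_eq0.
Qed.

Lemma G_o_symp2 g : G_o g -> symp2 g.
Proof.
move=> [sg go]; have sb := fun p => symp_boundary sg (p := p).
have [_ gD [h [_ _ hg _]] gj] := sg; split => //.
- exact: symp_regular.
- by split => // p q /disk_nsq Dp /disk_nsq Dq E; rewrite -(hg p Dp) E hg.
Qed.

(* The function F_g with dF_g = g^*eta - eta and F_g(o) = 0. *)
Definition gen g : plane -> R :=
  potential (fun p => pullP g p - eta_a p) (fun p => pullQ g p - eta_b p).

Lemma gen_origin g : gen g (@origin R) = 0.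
Proof. by rewrite /gen /potential /= !mul0r addr0. Qed.

(** [gen g] is C^1 on a ball around the disk, but the closedness of g^*eta - eta comes from [jac g]
    being 1 on the disk, so the partials are identified there. The radius of a point of the disk
    stays in the disk, as [potential_PD] asks. *)
Lemma gen_spec g : symp2 g -> exists rho : R, [/\ 1 < rho, Ck 1 (dball rho) (gen g) &
  forall p, D p -> PD (gen g) p (pullP g p - eta_a p) (pullQ g p - eta_b p)].
Proof.
move=> [[U rg] gD gj _ _]; have [oU DU _ _] := rg.
have [rho r1 rU] := dball_in oU DU; have oB := open_dball rho.
have [cP cQ] := pull_C1 rg.
have cPa := Ck_D oU cP (Ck_N oU (Ck_eta_a 1 oU)).
have cQb := Ck_D oU cQ (Ck_N oU (Ck_eta_b 1 oU)).
exists rho; split => //.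
  exact: potential_C1 (Ck_sub rU cPa) (Ck_sub rU cQb).
move=> p Dp; apply: (potential_PD (Ck_sub rU cPa) (Ck_sub rU cQb)).
  exact: disk_dball.
move=> t t01; have Dt := disk_sc t01 Dp; have Ut := DU _ Dt.
have Q := PD_D (Ck_PD cQ Ut) (PD_N (PD_eta_b (sc t p))).
have P := PD_D (Ck_PD cP Ut) (PD_N (PD_eta_a (sc t p))).
rewrite (PD_dx Q) (PD_dy P) {Q P}; have := pull_curl rg Ut; rewrite (gj _ Dt).
by move: (dx _ _) (dy _ _) => a b ab; rewrite -[a](subrK b) ab; field.
Qed.

Lemma gen_unique f F a b p : D p ->
  (forall q, D q -> PD f q (a q) (b q)) -> (forall q, D q -> PD F q (a q) (b q)) ->
  f (@origin R) = F (@origin R) -> f p = F p.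
Proof.
move=> Dp fE FE f0.
have sc1 : sc 1 p = p by rewrite /sc !mul1r -surjective_pairing.
have sc0 : sc 0 p = @origin R by rewrite /sc !mul0r.
suff : f (sc 0 p) - F (sc 0 p) = f (sc 1 p) - F (sc 1 p).
  by rewrite sc0 sc1 f0 subrr => /esym/subr0_eq.
apply: (@is_derive0_eq _ (fun t => f (sc t p) - F (sc t p))) => t.
rewrite min_l ?max_r ?ler01// => t01; have Dt := disk_sc t01 Dp.
have D1 := @PD_curve _ _ (fun s => s * p.1) (fun s => s * p.2) t _ _ _ _
    (fE _ Dt) (is_derive_scale t p.1) (is_derive_scale t p.2).
have D2 := @PD_curve _ _ (fun s => s * p.1) (fun s => s * p.2) t _ _ _ _
    (FE _ Dt) (is_derive_scale t p.1) (is_derive_scale t p.2).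
by apply: eq_is_derive (is_deriveB D1 D2) _; rewrite subrr.
Qed.

(** From (g o h)^*eta - eta = h^*(g^*eta - eta) + (h^*eta - eta): the two sides have the same
    differential on the disk, and agree at [o] because [h] fixes it. *)
Lemma gen_comp g h p : symp2 g -> symp2 h -> D p ->
  gen (g \o h) p = gen h p + gen g (h p).
Proof.
move=> sg sh Dp; have [_ [_ _ GE]] := gen_spec (symp2_comp sg sh).
have [_ [_ _ Gg]] := gen_spec sg; have [_ [_ _ Gh]] := gen_spec sh.
have [[W rg] _ _ _ _] := sg; have [[U rh] hD _ _ ho] := sh.
have [_ DU _ _] := rh; have [_ DW _ _] := rg.
apply: (@gen_unique _ (fun q => gen h q + gen g (h q)) _ _ p Dp GE); last first.
  by rewrite ho !gen_origin addr0.
move=> q Dq; have [h1 h2] := regular_PD rh (DU _ Dq).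
have [-> ->] := pull_comp rh rg (DU _ Dq) (DW _ (hD _ Dq)).
apply: PD_eq (PD_D (Gh q Dq) (PD_comp (Gg _ (hD _ Dq)) h1 h2)) _ _.
- rewrite [pullP h q]/pullP; move: (dx _ q) (dx _ q) => r1 r2; ring.
- rewrite [pullQ h q]/pullQ; move: (dy _ q) (dy _ q) => r1 r2; ring.
Qed.

End Symplectic.

(** * Angular lifts on the circle and invariance of area integrals *)

Section Circle.
Context {R : realType}.
Notation plane := (R * R)%type.
Notation D := (@disk R).
Notation pi := (@pi R).
Implicit Types (f : plane -> R) (p q : plane) (g h : plane -> plane) (t s : R)
  (E phi : R -> R).

Lemma nsq_circ t : nsq (circ t) = 1 :> R.
Proof. exact: cos2Dsin2. Qed.

Lemma circ_angle p : nsq p = 1 -> exists2 t : R, 0 <= t <= pi *+ 2 & circ t = p.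
Proof.
case: p => x y; rewrite /nsq/= => xy.
have x1 : -1 <= x <= 1 by apply/andP; split; nra.
have y2 : 1 - x ^+ 2 = y ^+ 2 by lra.
have a0 := acos_ge0 x1; have a1 := acos_lepi x1; have pi0 := @pi_gt0 R.
have ca : cos (acos x) = x by apply: acosK; rewrite in_itv.
have sa : sin (acos x) = `|y| by rewrite sin_acos// y2 sqrtr_sqr.
have [y0|y0] := leP 0 y.
  exists (acos x); first by rewrite a0/=; lra.
  by rewrite /circ ca sa ger0_norm.
exists (pi *+ 2 - acos x); first by apply/andP; split; lra.
rewrite /circ addrC cosD2pi sinD2pi cosN sinN ca sa ltr0_norm//.
by rewrite opprK.
Qed.

Lemma circ_eq0 t : 0 <= t < pi *+ 2 -> circ t = circ 0 :> plane -> t = 0.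
Proof.
move=> /andP[t0 t2]; rewrite /circ cos0 sin0 => -[c s].
apply/eqP; rewrite eq_le t0 andbT leNgt; apply/negP => tp.
have [tpi|tpi|tpi] := ltgtP t pi.
- by have := @sin_gt0_pi R t; rewrite tp tpi s ltxx => /(_ isT).
- have := @sin_gt0_pi R (t - pi); rewrite subr_gt0 tpi ltrBlDr -mulr2n t2.
  move=> /(_ isT).
  have -> : sin (t - pi) = - sin t.
    by rewrite -[t in RHS](subrK pi) sinDpi opprK.
  by rewrite s oppr0 ltxx.
- by move: c; rewrite tpi cospi; lra.
Qed.

(* The angular velocity of t |-> g (circ t): on the circle, 2 eta = d theta. *)
Definition speed g t := 2 * (pullQ g (circ t) * cos t - pullP g (circ t) * sin t).

Lemma speed_continuous U g : regular U g -> continuous (speed g).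
Proof.
move=> rg; have [cP cQ] := pull_C1 rg; have [oU DU _ _] := rg.
have P := continuous_circ DU (CkS cP); have Q := continuous_circ DU (CkS cQ).
move=> t; apply: cvgM; first exact: cvg_cst.
apply: cvgB; apply: cvgM;
  [exact: Q|exact: continuous_cos|exact: P|exact: continuous_sin].
Qed.

Lemma is_derive_circ f t a b : PD f (circ t) a b ->
  is_derive t 1 (fun s => f (circ s)) (b * cos t - a * sin t).
Proof.
move=> fab.
apply: eq_is_derive (@PD_curve _ f cos sin t _ _ _ _ fab (is_derive_cos t) (is_derive_sin t)) _.
ring.
Qed.

(** The curve [g (circ t)] stays on the circle, so it is orthogonal to its velocity and rotates with
    angular speed [speed g t]. Its inner product with [circ (phi t)] then has zero derivative and
    equals 1 at [t = 0]; unit vectors with inner product 1 coincide. *)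
Lemma circle_lift g : symp2 g -> exists phi, forall t : R,
  is_derive t 1 phi (speed g t) /\ g (circ t) = circ (phi t).
Proof.
move=> [[U rg] gD gj [gc _] _]; have [oU DU _ _] := rg.
have [E Es] := antiderivative (speed_continuous rg).
have [al _ alE] := circ_angle (gc _ (nsq_circ 0)).
pose phi t := E t - E 0 + al.
have phiE t : is_derive t 1 phi (speed g t).
  apply: eq_is_derive (is_deriveD (is_deriveB (Es t) (is_derive_cst (E 0) t 1)) (is_derive_cst al t 1)) _.
  by rewrite subr0 addr0.
pose H1 t := (g (circ t)).1; pose H2 t := (g (circ t)).2.
have HH t : H1 t ^+ 2 + H2 t ^+ 2 = 1 by exact: gc (nsq_circ t).
have Hd t : is_derive t 1 H1 (- speed g t * H2 t) /\ is_derive t 1 H2 (speed g t * H1 t).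
  have [g1 g2] := regular_PD rg (DU _ (disk_circ t)).
  have d1 := is_derive_circ g1; have d2 := is_derive_circ g2.
  have d0 : (dy (fun p => (g p).1) (circ t) * cos t - dx (fun p => (g p).1) (circ t) * sin t) * H1 t
     + (dy (fun p => (g p).2) (circ t) * cos t - dx (fun p => (g p).2) (circ t) * sin t) * H2 t = 0.
    have S : is_derive t 1 (fun s => H1 s * H1 s + H2 s * H2 s) 0.
      have -> : (fun s => H1 s * H1 s + H2 s * H2 s) = fun=> 1.
        by apply/funext => s; rewrite -(HH s) !expr2.
      exact: is_derive_cst.
    have S' := is_deriveD (is_deriveM d1 d1) (is_deriveM d2 d2).
    have [_ v1] := S; have [_ v2] := S'.
    have : 'D_1 (fun s => H1 s * H1 s + H2 s * H2 s) t = 0 by [].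
    have -> : (fun s => H1 s * H1 s + H2 s * H2 s) = ((fun s => (g (circ s)).1) * (fun s => (g (circ s)).1) + (fun s => (g (circ s)).2) * (fun s => (g (circ s)).2)) by [].
    rewrite v2 /GRing.scale/= -/(H1 t) -/(H2 t); lra.
  have := HH t; move: d0 d1 d2; rewrite /speed pullPE pullQE -/H1 -/H2 -/(H1 t) -/(H2 t).
  move: (dy (fun p => (g p).1) (circ t)) (dx (fun p => (g p).1) (circ t))
    (dy (fun p => (g p).2) (circ t)) (dx (fun p => (g p).2) (circ t)) => a b c d.
  move: (cos t) (sin t) (H1 t) (H2 t) => x y u v d0 d1 d2 uv.
  split; [apply: eq_is_derive d1 _|apply: eq_is_derive d2 _].
  - transitivity ((a * x - b * y) * (u ^+ 2 + v ^+ 2) -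
      ((a * x - b * y) * u + (c * x - d * y) * v) * u); first by rewrite d0 uv; ring.
    by field.
  - transitivity ((c * x - d * y) * (u ^+ 2 + v ^+ 2) -
      ((a * x - b * y) * u + (c * x - d * y) * v) * v); first by rewrite d0 uv; ring.
    by field.
exists phi => t; split; first exact: phiE.
have cst (s : R) : is_derive s 1 (fun s => H1 s * cos (phi s) + H2 s * sin (phi s)) 0.
  have [h1 h2] := Hd s.
  have c := is_derive1_comp (is_derive_cos (phi s)) (phiE s).
  have c' := is_derive1_comp (is_derive_sin (phi s)) (phiE s).
  apply: eq_is_derive (is_deriveD (is_deriveM h1 c) (is_deriveM h2 c')) _.
  by rewrite /GRing.scale/=; ring.
have a1 : H1 t * cos (phi t) + H2 t * sin (phi t) = 1.
  rewrite -(@is_derive0_eq _ _ 0 t (fun s _ => cst s)).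
  rewrite /H1 /H2 -alE /circ/= /phi subrr add0r -!expr2; exact: cos2Dsin2.
have := HH t; have := cos2Dsin2 (phi t); move: a1.
rewrite [g (circ t)]surjective_pairing /circ -/(H1 t) -/(H2 t).
move: (H1 t) (H2 t) (cos (phi t)) (sin (phi t)) => u v c s a1 cs uv.
have : (u - c) ^+ 2 + (v - s) ^+ 2 = 0.
  transitivity ((u ^+ 2 + v ^+ 2) + (c ^+ 2 + s ^+ 2) - 2 * (u * c + v * s)); first ring.
  by rewrite uv cs a1; ring.
move/eqP; rewrite paddr_eq0 ?sqr_ge0// !sqrf_eq0 !subr_eq0 => /andP[/eqP -> /eqP ->].
by [].
Qed.

(** Green's formula for g^*eta, whose curl is [jac g] and whose restriction to the circle is
    [speed g t / 2] times dt. *)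
Lemma intD_curl U g phi : regular U g -> (forall p, D p -> jac g p = 1) ->
  (forall t, is_derive t 1 phi (speed g t)) ->
  intD (fun=> 1) = (phi (pi *+ 2) - phi 0) / 2.
Proof.
move=> rg gj phiE; have [cP cQ] := pull_C1 rg; have [oU DU _ _] := rg.
rewrite -(@eq_intD _ (fun p => dx (pullQ g) p - dy (pullP g) p)); last first.
  by move=> p Dp; rewrite (pull_curl rg (DU _ Dp)) gj.
have E t : is_derive t 1 (fun t => 2^-1 * phi t)
    (pullQ g (circ t) * cos t - pullP g (circ t) * sin t).
  apply: eq_is_derive (is_deriveZ (2^-1) (phiE t)) _.
  by rewrite /speed /GRing.scale/= mulrA mulVf ?mul1r.
by rewrite (green oU DU cP cQ E); field.
Qed.

Lemma speed_id t : speed id t = 1 :> R.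
Proof.
rewrite /speed /pullP /pullQ !(PD_dx (PD_fst _)) !(PD_dx (PD_snd _)).
rewrite !(PD_dy (PD_fst _)) !(PD_dy (PD_snd _)) /eta_a /eta_b /circ/=.
transitivity (cos t ^+ 2 + sin t ^+ 2); first by field.
exact: cos2Dsin2.
Qed.

Lemma disk_area : intD (fun=> 1) = pi.
Proof.
have [_ _ j1 _ _] := @symp2_id R.
have E t : is_derive t 1 id (speed id t) by rewrite speed_id; exact: is_derive_id.
by rewrite (intD_curl (@regular_id R) j1 E) subr0; field.
Qed.

(** The lift turns by twice the area of the disk, and [disk_area] obtains that area from the same
    identity applied to [id]. *)
Lemma lift_degree g phi : symp2 g -> (forall t, is_derive t 1 phi (speed g t)) ->
  phi (pi *+ 2) = phi 0 + pi *+ 2.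
Proof.
move=> [[U rg] _ gj _ _] /(intD_curl rg gj); rewrite disk_area; lra.
Qed.

(** With m = [radint 1 f], Euler's identity gives f omega = d(2 m eta), hence (f o h) omega = d(2 (m
    o h) h^*eta) as [h] preserves omega. On the circle the last primitive is m(circ phi) dphi, with
    antiderivative M o phi. *)
Lemma intD_comp_lift rho f h phi M : 1 < rho -> Ck 1 (dball rho) f -> symp2 h ->
  (forall t : R, is_derive t 1 phi (speed h t) /\ h (circ t) = circ (phi t)) ->
  (forall t : R, is_derive t 1 M (radint 1 f (circ t))) ->
  intD (fun p => f (h p)) = M (phi (pi *+ 2)) - M (phi 0).
Proof.
move=> r1 cf [[U rh] hD hj _ _] phiE ME; have [oU DU c1 c2] := rh.
have oB := open_dball rho; have DB := disk_dball r1.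
have [V [oV DV VU VB]] := regular_preimage rh hD oB DB.
have [cP cQ] := pull_C1 rh.
have cm := radint_C1 1 cf.
have cmh : Ck 1 V (fun p => radint 1 f (h p)).
  exact: (Ck_comp oV VB cm (CkS (Ck_sub VU c1)) (CkS (Ck_sub VU c2))).
have cA := Ck_Z 2 oV (Ck_M oV cmh (Ck_sub VU cP)).
have cB := Ck_Z 2 oV (Ck_M oV cmh (Ck_sub VU cQ)).
have E t : is_derive t 1 (fun t => M (phi t))
    (2 * (radint 1 f (h (circ t)) * pullQ h (circ t)) * cos t -
     2 * (radint 1 f (h (circ t)) * pullP h (circ t)) * sin t).
  have [p1 p2] := phiE t.
  apply: eq_is_derive (is_derive1_comp (ME (phi t)) p1) _.
  by rewrite p2 /speed; move: (radint _ _ _) (pullQ _ _) (pullP _ _) => a b c; ring.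
rewrite -(green oV DV cA cB E).
apply: eq_intD => p Dp; have Vp := DV _ Dp; have Up := DU _ Dp.
have [h1 h2] := regular_PD rh Up.
have m := PD_comp (radint_PD 1 cf (VB _ Vp)) h1 h2.
have B' := PD_Z 2 (PD_M m (Ck_PD cQ Up)).
have A' := PD_Z 2 (PD_M m (Ck_PD cP Up)).
rewrite (PD_dx B') (PD_dy A') -[LHS](radint_euler 1 cf (VB _ Vp)) {A' B' m cA cB}.
have := pull_curl rh Up; rewrite (hj _ Dp).
move: (dx (pullQ h) p) (dy (pullP h) p) => qx py.
move: (hj _ Dp); rewrite /jac [pullQ h]pullQE [pullP h]pullPE.
move: (dx (fun q => (h q).1) p) (dx (fun q => (h q).2) p)
  (dy (fun q => (h q).1) p) (dy (fun q => (h q).2) p) => a b c d j qp.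
move: (radint 1 f (h p)) (radint 2 (dx f) (h p)) (radint 2 (dy f) (h p)) => w mx my.
have -> : qx = 1 + py by lra.
transitivity (2 * w + (h p).1 * mx * (a * d - c * b) + (h p).2 * my * (a * d - c * b)).
  by rewrite j; ring.
by field.
Qed.

(** The same [M] serves [h] and [id]: the two lifts run over full turns from possibly different
    starting points, and [M] has the same increment over each. *)
Lemma intD_symp2 rho f h : 1 < rho -> Ck 1 (dball rho) f -> symp2 h ->
  intD (fun p => f (h p)) = intD f.
Proof.
move=> r1 cf sh; have [phi phiE] := circle_lift sh.
have cm : continuous (fun t => radint 1 f (circ t)).
  exact: continuous_circ (disk_dball r1) (CkS (radint_C1 1 cf)).
have [M ME] := antiderivative cm.
rewrite (intD_comp_lift r1 cf sh phiE ME).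
have idE t : is_derive t 1 id (speed id t) /\ id (circ t) = circ (id t) :> plane.
  by rewrite speed_id; split => //; exact: is_derive_id.
rewrite -[intD f]/(intD (fun p => f (id p))) (intD_comp_lift r1 cf (@symp2_id R) idE ME).
rewrite (lift_degree sh (fun t => (phiE t).1)).
by apply: is_derive_periodic ME _ => t; rewrite /circ cosD2pi sinD2pi.
Qed.

End Circle.

(** * Asymptotics along iterates *)

Section QuasiAdditive.
Context {R : realType}.

(** Each added block costs one [C], and the start at [n = 0] one more, since [a 0] is bounded by [C]
    but may be nonzero. *)
Lemma quasi_additive_mul (a : nat -> R) (C : R) :
  (forall m n, `|a (m + n)%N - a m - a n| <= C) ->
  forall m n, `|a (m * n)%N - n%:R * a m| <= n.+1%:R * C.
Proof.
move=> aC m; elim=> [|n IH].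
  by rewrite muln0 !mul0r subr0 mul1r; have := aC 0%N 0%N; rewrite addn0 subrr sub0r normrN.
rewrite mulnS; have := lerD (aC m (m * n)%N) IH.
move/(le_trans (ler_normD _ _)) => H; apply: le_trans (_ : C + n.+1%:R * C <= _).
  apply: le_trans H; rewrite le_eqVlt; apply/orP; left; apply/eqP; congr (`|_|).
  by rewrite -[n.+1]addn1 natrD; ring.
by rewrite -[n.+2]addn1 natrD le_eqVlt; apply/orP; left; apply/eqP; ring.
Qed.

(** Both quotients are compared with the value of [a] at [m.+1 * n.+1], divided by that product. *)
Lemma quasi_additive_cauchy (a : nat -> R) (C : R) :
  (forall m n, `|a (m + n)%N - a m - a n| <= C) -> forall m n,
  `|a m.+1 / m.+1%:R - a n.+1 / n.+1%:R| <= 2 * C * (m.+1%:R^-1 + n.+1%:R^-1).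
Proof.
move=> aC m n; have C0 : 0 <= C by apply: le_trans (aC 0%N 0%N).
have H1 := quasi_additive_mul aC m.+1 n.+1; have H2 := quasi_additive_mul aC n.+1 m.+1.
rewrite mulnC in H2.
have [m1 n1] : 1 <= m.+1%:R :> R /\ 1 <= n.+1%:R :> R by rewrite !ler1n.
rewrite -[in X in _ <= X]addn1 natrD in H1; rewrite -[in X in _ <= X]addn1 natrD in H2.
move: H1 H2 m1 n1; move: (a _) (a m.+1) (a n.+1) (m.+1%:R) (n.+1%:R) => u v w x y.
move=> H1 H2 x1 y1; have x0 : 0 < x by lra.
have y0 : 0 < y by lra.
have -> : v / x - w / y = (y * v - x * w) / (x * y) by field; rewrite !gt_eqF.
have -> : 2 * C * (x^-1 + y^-1) = (2 * C * (x + y)) / (x * y) by field; rewrite !gt_eqF.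
have xy0 : 0 < x * y by exact: mulr_gt0.
rewrite normrM (gtr0_norm (x := (x * y)^-1)) ?invr_gt0// ler_pM2r ?invr_gt0//.
have -> : y * v - x * w = (u - x * w) - (u - y * v) by ring.
apply: le_trans (ler_normB _ _) _; apply: le_trans (lerD H2 H1) _.
have : 0 <= C * (x + y - 2) by apply: mulr_ge0 => //; lra.
lra.
Qed.

(** [limn] returns a default value on divergent sequences, so convergence has to be secured before
    homogenizations can be combined. *)
Lemma quasi_additive_cvg (a : nat -> R) (C : R) :
  (forall m n, `|a (m + n)%N - a m - a n| <= C) -> cvgn (fun n => a n / n%:R).
Proof.
move=> aC; have C0 : 0 <= C by apply: le_trans (aC 0%N 0%N).
apply: cauchy_cvg; apply: cauchy_exP => e e0.
(* From this index on, the Cauchy bound is at most 2 C (1/(N+1) + 1/(N+1)) = 4 C / (N+1). *)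
pose N := Num.bound (4 * C / e).
have NB : 4 * C / e < N%:R by apply: archi_boundP; rewrite divr_ge0// ?mulr_ge0// ltW.
exists (a N.+1 / N.+1%:R); exists N.+1 => // n /=; case: n => // n Nn.
apply: le_lt_trans (quasi_additive_cauchy aC N n) _.
have N0 : 0 < N.+1%:R :> R by rewrite ltr0n.
have n0 : 0 < n.+1%:R :> R by rewrite ltr0n.
have nN : n.+1%:R^-1 <= N.+1%:R^-1 :> R by rewrite lef_pV2 ?posrE// ler_nat.
apply: le_lt_trans (_ : 2 * C * (N.+1%:R^-1 + N.+1%:R^-1) < e).
  by rewrite ler_wpM2l ?lerD2l// mulr_ge0.
have -> : 2 * C * (N.+1%:R^-1 + N.+1%:R^-1) = 4 * C / N.+1%:R :> R by ring.
rewrite ltr_pdivrMr// [e * _]mulrC -ltr_pdivrMr//; apply: lt_trans NB _.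
by rewrite ltr_nat.
Qed.

Lemma cvg_bounded_div (u : nat -> R) (l C : R) :
  (forall n, `|n.+1%:R * (u n.+1 - l)| <= C) -> u @ \oo --> l.
Proof.
move=> uC; have C0 : 0 <= C by apply: le_trans (uC 0%N).
apply/cvgrPdist_le => e e0; pose N := Num.bound (C / e).
have NB : C / e < N%:R by apply: archi_boundP; rewrite divr_ge0// ltW.
exists N.+1 => // n /=; case: n => // n Nn.
rewrite distrC -(ler_pM2l (x := n.+1%:R)) ?ltr0n//.
rewrite -[X in X * `|_|]gtr0_norm ?ltr0n// -normrM; apply: le_trans (uC n) _.
rewrite -ler_pdivrMr//; apply: le_trans (ltW NB) _; rewrite ler_nat; exact: ltnW.
Qed.

End QuasiAdditive.

Opaque gen intD.

(** * Comparison of tau and sigma through the generating function *)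

Section TauSigma.
Context {R : realType}.
Notation plane := (R * R)%type.
Notation D := (@disk R).
Notation pi := (@pi R).
Implicit Types (f : plane -> R) (p q : plane) (g h : plane -> plane) (t s : R).

(** On the circle eta restricts to dt / 2, and g^*eta to [speed g t / 2] times dt. *)
Lemma is_derive_gen_circ g t : symp2 g ->
  is_derive t 1 (fun s => gen g (circ s)) (2^-1 * (speed g t - 1)).
Proof.
move=> sg; have [_ [_ _ G]] := gen_spec sg.
apply: eq_is_derive (is_derive_circ (G _ (disk_circ t))) _.
have := cos2Dsin2 t; rewrite /speed /eta_a /eta_b.
rewrite -[(circ t).1]/(cos t) -[(circ t).2]/(sin t).
move: (pullP g (circ t)) (pullQ g (circ t)) => a b.
move: (cos t) (sin t) => c s cs.
transitivity (b * c - a * s - 2^-1 * (c ^+ 2 + s ^+ 2)); first by field.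
by rewrite cs; field.
Qed.

(* By injectivity on the circle, the lift cannot move past a full turn. *)
Lemma lift_bound g (phi : R -> R) t : symp2 g ->
  (forall t, is_derive t 1 phi (speed g t) /\ g (circ t) = circ (phi t)) ->
  0 <= t <= pi *+ 2 -> `|phi t - phi 0| <= pi *+ 2.
Proof.
move=> [_ _ _ [_ gi] _] phiE /andP[t0 t2]; have pi0 := @pi_gt0 R.
rewrite leNgt; apply/negP => tb.
(* Such a [v] is [phi s] with [s < t] by the intermediate value theorem, and injectivity on the
   circle forces [s = 0]. The values to be excluded are [phi 0] plus or minus a full turn. *)
have key (v : R) : circ v = circ (phi 0) :> plane -> v != phi 0 -> v != phi t ->
    Num.min (phi 0) (phi t) <= v <= Num.max (phi 0) (phi t) -> False.
  move=> cv v0 vt vb; have [|s s01 sv] := IVT t0 _ vb.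
    apply: derivable_within_continuous => s _; by have [[]] := phiE s.
  move: s01; rewrite in_itv/= => /andP[s0 st].
  have : circ s = circ 0 :> plane.
    apply: gi; rewrite ?nsq_circ//.
    by have [_ ->] := phiE s; have [_ ->] := phiE 0; rewrite sv.
  have st' : s < t.
    by rewrite lt_neqAle st andbT; apply: contra_neq vt => <-.
  have s02 : 0 <= s < pi *+ 2 by rewrite s0 (lt_le_trans st' t2).
  by move=> /(circ_eq0 s02) sE; move: v0; rewrite -sv sE eqxx.
have cper (x : R) : circ (x + pi *+ 2) = circ x :> plane.
  by rewrite /circ cosD2pi sinD2pi.
have [p0|p0] := leP (phi 0) (phi t).
  rewrite ger0_norm ?subr_ge0// in tb.
  apply: (key (phi 0 + pi *+ 2)) => //.
  - by apply/eqP; lra.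
  - by apply/eqP; lra.
  - by rewrite min_l// max_r//; apply/andP; split; lra.
rewrite ltr0_norm ?subr_lt0// in tb.
apply: (key (phi 0 - pi *+ 2)).
- by rewrite -[in RHS](subrK (pi *+ 2) (phi 0)) cper.
- by apply/eqP; lra.
- by apply/eqP; lra.
- by rewrite min_r ?max_l ?(ltW p0)//; apply/andP; split; lra.
Qed.

(** The increment of F_g along the circle is half that of [phi s - s], and both [phi t - phi 0] and
    [t] are at most 2 pi in absolute value. *)
Lemma gen_osc g q : symp2 g -> nsq q = 1 ->
  `|gen g q - gen g (circ 0)| <= pi *+ 2.
Proof.
move=> sg /circ_angle[t t2 <-]; have [phi phiE] := circle_lift sg.
have lb := lift_bound sg phiE t2.
have E : gen g (circ t) - gen g (circ 0) = 2^-1 * (phi t - t) - 2^-1 * (phi 0 - 0).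
  apply: (@antiderivative_eq _ (fun s => gen g (circ s)) (fun s => 2^-1 * (phi s - s))
    (fun s => 2^-1 * (speed g s - 1)) 0 t) => s _; first exact: is_derive_gen_circ.
  exact: is_deriveZ (is_deriveB (phiE s).1 (is_derive_id s 1)).
rewrite E; move: lb t2; rewrite !ler_norml => /andP[? ?] /andP[? ?].
by apply/andP; split; lra.
Qed.

Lemma sigma_gen g : symp2 g -> sigma g = gen g (circ 0).
Proof.
move=> sg; have [_ [_ _ G]] := gen_spec sg.
have [[U rg] _ _ _ _] := sg; have [oU DU _ _] := rg.
have [cP _] := pull_C1 rg; have ca := Ck_eta_a 0 oU.
have D0 t : 0 <= t <= 1 -> D (t, 0).
  by move=> t01; rewrite /disk/= expr0n/= addr0 sqr01.
have c1 : cont01 (fun t => pullP g (t, 0) - eta_a (t, 0)).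
  move=> t t01; have Ut := DU _ (D0 t t01).
  apply: (@continuous_plane _ _ (fun p => pullP g p - eta_a p) (fun s => (s, 0))).
  - apply: cvgB; [exact: Ck_continuous cP Ut|exact: Ck_continuous ca Ut].
  - exact: cvg_id.
  - exact: cvg_cst.
have d1 t : 0 <= t <= 1 ->
    is_derive t 1 (fun t => gen g (t, 0)) (pullP g (t, 0) - eta_a (t, 0)).
  by move=> t01; exact: PD_x (G _ (D0 t t01)).
rewrite /sigma -[LHS]/(int01 _) (int01_FTC c1 d1).
by rewrite -[(0, 0)]/(@origin R) gen_origin subr0 /circ cos0 sin0.
Qed.

(** Since eta /\ eta = 0, g^*eta may be replaced by dF_g in [tau], and dF_g /\ eta = d(F_g eta) -
    F_g omega. Green's formula is applied to 2 F_g eta = -y F_g dx + x F_g dy, whence the factor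
    [2^-1]. *)
Lemma tau_gen g E : symp2 g -> (forall t, is_derive t 1 E (gen g (circ t))) ->
  tau g = 2^-1 * (E (pi *+ 2) - E 0) - intD (gen g).
Proof.
move=> sg EE; have [rho [r1 cG G]] := gen_spec sg.
have oB := open_dball rho; have DB := disk_dball r1.
have cA := Ck_M oB (Ck_N oB (Ck_snd 1 oB)) cG.
have cB := Ck_M oB (Ck_fst 1 oB) cG.
have E' t : is_derive t 1 E ((circ t).1 * gen g (circ t) * cos t
    - (- (circ t).2 * gen g (circ t)) * sin t).
  apply: eq_is_derive (EE t) _; rewrite /circ/=.
  have cs := cos2Dsin2 t; move: (gen g _) cs => u cs.
  transitivity (u * (cos t ^+ 2 + sin t ^+ 2)); first by rewrite cs mulr1.
  ring.
have cG0 : contD (gen g) by apply: Ck_contD DB _; exact: CkS.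
rewrite -(green oB DB cA cB E') -intDZ; last first.
  move=> p Dp; apply: cvgB.
  - exact: Ck_contD DB (Ck_dx cB) p Dp.
  - exact: Ck_contD DB (Ck_dy cA) p Dp.
rewrite -intDB//; last first.
  move=> p Dp; apply: cvgM; first exact: cvg_cst.
  apply: cvgB.
  - exact: Ck_contD DB (Ck_dx cB) p Dp.
  - exact: Ck_contD DB (Ck_dy cA) p Dp.
apply: eq_intD => p Dp; have Gp := G p Dp.
rewrite (PD_dx (PD_M (PD_fst p) Gp)) (PD_dy (PD_M (PD_N (PD_snd p)) Gp)).
rewrite /eta_a /eta_b; move: (pullP g p) (pullQ g p) (gen g p) => a b c.
by field.
Qed.

(** On the circle F_g is within 2 pi of its value at [circ 0], which is [sigma g], so its integral
    is within 2 pi times 2 pi of 2 pi [sigma g]. Halving gives both the coefficient pi of [sigma]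
    and the bound. *)
Lemma tau_sigma_bound g : symp2 g ->
  `|tau g - pi * sigma g + intD (gen g)| <= pi * (pi *+ 2).
Proof.
move=> sg; have pi0 := @pi_gt0 R; have [rho [r1 cG G]] := gen_spec sg.
have [E EE] := antiderivative (continuous_circ (disk_dball r1) (CkS cG)).
have := @MVT_dist _ E (fun t => gen g (circ t)) (gen g (circ 0)) (pi *+ 2) 0 (pi *+ 2).
move=> /(_ _)/= H; have {}H : `|E (pi *+ 2) - E 0 - gen g (circ 0) * (pi *+ 2 - 0)| <= pi *+ 2 * `|pi *+ 2 - 0|.
  by apply: H => s _; split; [exact: EE|apply: gen_osc => //; exact: nsq_circ].
rewrite (tau_gen sg EE) (sigma_gen sg).
have p20 : 0 < pi *+ 2 by lra.
move: H; rewrite subr0 (gtr0_norm p20).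
move: (E (pi *+ 2)) (E 0) (intD _) (gen g _) => a b c d.
have -> : 2^-1 * (a - b) - c - pi * d + c = 2^-1 * (a - b - d * (pi *+ 2)) by field.
have h2 : 0 < 2^-1 :> R by rewrite invr_gt0.
rewrite normrM (gtr0_norm h2) -(ler_pM2l h2) => /le_trans; apply.
rewrite le_eqVlt; apply/orP; left; apply/eqP; by field.
Qed.

Lemma gen_contD g : symp2 g -> contD (gen g).
Proof.
move=> sg; have [rho [r1 cG G]] := gen_spec sg.
by apply: Ck_contD (disk_dball r1) _; exact: CkS.
Qed.

Lemma intD_gen_comp g h : symp2 g -> symp2 h ->
  intD (gen (g \o h)) = intD (gen g) + intD (gen h).
Proof.
move=> sg sh; have [rho [r1 cG G]] := gen_spec sg.
transitivity (intD (fun p => gen h p + gen g (h p))).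
  by apply: eq_intD => p Dp; exact: gen_comp.
have [[U rh] hD _ _ _] := sh.
have cgh : contD (fun p => gen g (h p)).
  move=> p Dp; have [_ DU c1 c2] := rh; have Up := DU _ Dp.
  apply: (@continuous_plane _ _ (gen g) h).
  - exact: gen_contD (hD _ Dp).
  - exact: Ck_continuous c1 Up.
  - exact: Ck_continuous c2 Up.
have key (u x y z : R) : u = x + y -> y = z -> u = z + x by move=> -> ->; exact: addrC.
exact: key (intDD (gen_contD sh) cgh) (intD_symp2 r1 cG sh).
Qed.

Lemma intD_gen_iter g n : symp2 g -> intD (gen (iter n g)) = n%:R * intD (gen g).
Proof.
move=> sg; elim: n => [|n IH].
  have := intD_gen_comp (@symp2_id R) (@symp2_id R).
  by rewrite -[iter 0 g]/id mul0r -[X in gen X]/id; lra.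
have key (u x y : R) : u = x + y -> y = n%:R * x -> u = n.+1%:R * x.
  by move=> -> ->; rewrite -[n.+1]addn1 natrD; ring.
exact: key (intD_gen_comp sg (symp2_iter n sg)) IH.
Qed.

(** By [gen_comp] the defect is a difference of two boundary values of [gen (iter m g)], to which
    [gen_osc] applies. *)
Lemma sigma_iter_quasi g : symp2 g -> forall m n,
  `|sigma (iter (m + n) g) - sigma (iter m g) - sigma (iter n g)| <= pi *+ 2.
Proof.
move=> sg m n; have sm := symp2_iter m sg; have sn := symp2_iter n sg.
have -> : iter (m + n) g = iter m g \o iter n g by apply/funext => p; rewrite iterD.
rewrite (sigma_gen sm) (sigma_gen sn) (sigma_gen (symp2_comp sm sn)).
rewrite (gen_comp sm sn (disk_circ 0)).
have [_ _ _ [nc _] _] := sn.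
have key (a b c r : R) : `|b - c| <= r -> `|a + b - c - a| <= r.
  by rewrite (_ : a + b - c - a = b - c); last ring.
exact: key (gen_osc sm (nc _ (nsq_circ 0))).
Qed.

(** In [tau_sigma_bound] for the iterates, divided by [n], the bounded error disappears in the
    limit, while the area term is exactly linear in [n] by [intD_gen_iter]. Convergence for [tau] is
    then deduced from that for [sigma]. *)
Lemma tau_bar_sigma_bar g : symp2 g ->
  tau_bar g - pi * sigma_bar g = - intD (gen g).
Proof.
move=> sg; pose a n := sigma (iter n g).
have ca := quasi_additive_cvg (a := a) (sigma_iter_quasi sg).
have cu : (fun n => tau (iter n g) / n%:R - pi * (a n / n%:R)) @ \oo --> - intD (gen g).
  apply: (@cvg_bounded_div _ _ _ (pi * (pi *+ 2))) => n.
  have key (u v w x r : R) : `|u - pi * v + w| <= r -> w = n.+1%:R * x ->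
      `|n.+1%:R * (u / n.+1%:R - pi * (v / n.+1%:R) - - x)| <= r.
    move=> H wE; move: H; rewrite wE; congr (`|_| <= _).
    by field; rewrite addrC natr1 pnatr_eq0.
  exact: key (tau_sigma_bound (symp2_iter n.+1 sg)) (intD_gen_iter n.+1 sg).
have cp : (fun n => pi * (a n / n%:R)) @ \oo --> pi * limn (fun n => a n / n%:R).
  by apply: cvgM; [exact: cvg_cst|exact: ca].
have ct : (fun n => tau (iter n g) / n%:R) @ \oo -->
    - intD (gen g) + pi * limn (fun n => a n / n%:R).
  apply: cvg_trans (cvgD cu cp); apply: near_eq_cvg; apply: nearW => n.
  by rewrite /= subrK.
have L : tau_bar g = - intD (gen g) + pi * limn (fun n => a n / n%:R).
  exact: cvg_lim ct.
by rewrite L -[sigma_bar g]/(limn (fun n => a n / n%:R)) addrK.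
Qed.

End TauSigma.

(** * Continuity and surjectivity *)

Section Continuity.
Context {R : realType}.
Notation plane := (R * R)%type.
Notation D := (@disk R).
Notation pi := (@pi R).
Implicit Types (f : plane -> R) (p q : plane) (g h : plane -> plane) (t s : R).

Lemma disk_coord_norm p : D p -> `|p.1| <= 1 /\ `|p.2| <= 1.
Proof. by move=> /disk_coord[]; rewrite !ler_norml. Qed.

Lemma pull_near (u v a b u' v' a' b' d M : R) : `|v'| <= 1 ->
  `|a| <= M -> `|b| <= M -> 0 <= d ->
  `|u' - u| <= d -> `|v' - v| <= d -> `|a' - a| <= d -> `|b' - b| <= d ->
  `|u'| <= 1 ->
  `|(- v' / 2 * a' + u' / 2 * b') - (- v / 2 * a + u / 2 * b)| <= d * (1 + M).
Proof.
move=> v1 aM bM d0 uu vv aa bb u1'.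
have -> : (- v' / 2 * a' + u' / 2 * b') - (- v / 2 * a + u / 2 * b) =
  2^-1 * ((u' * (b' - b) + (u' - u) * b) - (v' * (a' - a) + (v' - v) * a)) by field.
have H1 : `|u' * (b' - b) + (u' - u) * b| <= d + d * M.
  apply: le_trans (ler_normD _ _) _; rewrite !normrM; apply: lerD; last exact: ler_pM.
  by rewrite -[leRHS]mul1r; exact: ler_pM.
have H2 : `|v' * (a' - a) + (v' - v) * a| <= d + d * M.
  apply: le_trans (ler_normD _ _) _; rewrite !normrM; apply: lerD; last exact: ler_pM.
  by rewrite -[leRHS]mul1r; exact: ler_pM.
have h2 : 0 < 2^-1 :> R by rewrite invr_gt0.
rewrite normrM (gtr0_norm h2); have := le_trans (ler_normB _ _) (lerD H1 H2).
rewrite -(ler_pM2l h2) => /le_trans; apply.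
by rewrite le_eqVlt; apply/orP; left; apply/eqP; field.
Qed.

Lemma small_step (M K e : R) : 0 <= M -> 0 <= K -> 0 < e ->
  exists2 d : R, 0 < d & (d * (1 + M) + d * (1 + M)) * K < e.
Proof.
(* [K + 1] keeps [c] positive when [K] is 0; with [d = e / (2 * c)] the left side is at most
   [e / 2]. *)
move=> M0 K0 e0; pose c := 2 * (1 + M) * (K + 1).
have c0 : 0 < c by rewrite /c !mulr_gt0//; lra.
exists (e / (2 * c)); first by rewrite divr_gt0// mulr_gt0.
apply: (@le_lt_trans _ _ (e / (2 * c) * c)).
  rewrite (_ : _ * K = e / (2 * c) * (2 * (1 + M) * K)); last by ring.
  rewrite ler_wpM2l//; first by rewrite ltW// divr_gt0// mulr_gt0.
  by rewrite /c ler_wpM2l//; lra.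
rewrite (_ : e / (2 * c) * c = e / 2); last by field; rewrite gt_eqF.
lra.
Qed.

(** The difference of the two primitives vanishes at [o]; in its derivative along the radius eta
    cancels, and each coordinate contributes at most [c]. *)
Lemma gen_near g h (c : R) : symp2 g -> symp2 h ->
  (forall p, D p -> `|pullP h p - pullP g p| <= c) ->
  (forall p, D p -> `|pullQ h p - pullQ g p| <= c) ->
  forall p, D p -> `|gen h p - gen g p| <= c + c.
Proof.
move=> sg sh cP cQ p Dp.
have [_ [_ _ G]] := gen_spec sg; have [_ [_ _ H]] := gen_spec sh.
have sc1 : sc 1 p = p by rewrite /sc !mul1r -surjective_pairing.
have sc0 : sc 0 p = @origin R by rewrite /sc !mul0r.
have [p1 p2] := disk_coord_norm Dp.
pose F t := gen h (sc t p) - gen g (sc t p).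
pose dF t := (pullP h (sc t p) - pullP g (sc t p)) * p.1 +
  (pullQ h (sc t p) - pullQ g (sc t p)) * p.2.
have FE (t : R) : Num.min 0 1 <= t <= Num.max 0 1 ->
    is_derive t 1 F (dF t) /\ `|dF t - 0| <= c + c.
  rewrite min_l ?max_r ?ler01// => t01; have Dt := disk_sc t01 Dp.
  have D1 := @PD_curve _ _ (fun s => s * p.1) (fun s => s * p.2) t _ _ _ _
    (G _ Dt) (is_derive_scale t p.1) (is_derive_scale t p.2).
  have D2 := @PD_curve _ _ (fun s => s * p.1) (fun s => s * p.2) t _ _ _ _
    (H _ Dt) (is_derive_scale t p.1) (is_derive_scale t p.2).
  split.
    apply: eq_is_derive (is_deriveB D2 D1) _; rewrite /dF.
    move: (pullP h _) (pullP g _) (pullQ h _) (pullQ g _) (eta_a _) (eta_b _).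
    by move=> a b e k l m; ring.
  rewrite subr0 /dF; have := cP _ Dt; have := cQ _ Dt.
  move: (pullP h _ - _) (pullQ h _ - _) => a b bc ac.
  apply: le_trans (ler_normD _ _) _; rewrite !normrM.
  by apply: lerD; rewrite -[leRHS]mulr1; apply: ler_pM.
have F0 : F 0 = 0 by rewrite /F sc0 (gen_origin h) (gen_origin g) subrr.
have F1 : F 1 = gen h p - gen g p by rewrite /F sc1.
have key (a b r : R) : `|a - b - 0 * (1 - 0)| <= r * `|1 - 0| -> b = 0 -> `|a| <= r.
  by move=> + b0; rewrite b0 mul0r !subr0 normr1 mulr1.
by rewrite -F1; exact: key (MVT_dist FE) F0.
Qed.

Lemma intD_gen_continuous g : G_o g -> forall e : R, 0 < e ->
  exists (k : nat) (d : R), 0 < d /\ forall h, G_o h ->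
    (forall w : seq bool, (size w <= k)%N -> forall p, D p ->
       `| pd w (fun q => (h q).1) p - pd w (fun q => (g q).1) p | < d /\
       `| pd w (fun q => (h q).2) p - pd w (fun q => (g q).2) p | < d) ->
    `|intD (gen h) - intD (gen g)| < e.
Proof.
move=> Gg e e0; have sg := G_o_symp2 Gg.
have [[U rg] _ _ _ _] := sg; have [_ DU c1 c2] := rg.
have [M1 _ B1] := contD_bounded (Ck_contD DU (CkS (Ck_dx c1))).
have [M2 _ B2] := contD_bounded (Ck_contD DU (CkS (Ck_dy c1))).
have [M3 _ B3] := contD_bounded (Ck_contD DU (CkS (Ck_dx c2))).
have [M4 _ B4] := contD_bounded (Ck_contD DU (CkS (Ck_dy c2))).
pose M := `|M1| + `|M2| + `|M3| + `|M4|.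
have nM1 := normr_ge0 M1; have nM2 := normr_ge0 M2.
have nM3 := normr_ge0 M3; have nM4 := normr_ge0 M4.
have lM1 := ler_norm M1; have lM2 := ler_norm M2.
have lM3 := ler_norm M3; have lM4 := ler_norm M4.
have B1' p : D p -> `|dx (fun q => (g q).1) p| <= M.
  by move=> /B1 H; apply: le_trans H _; rewrite /M; lra.
have B2' p : D p -> `|dy (fun q => (g q).1) p| <= M.
  by move=> /B2 H; apply: le_trans H _; rewrite /M; lra.
have B3' p : D p -> `|dx (fun q => (g q).2) p| <= M.
  by move=> /B3 H; apply: le_trans H _; rewrite /M; lra.
have B4' p : D p -> `|dy (fun q => (g q).2) p| <= M.
  by move=> /B4 H; apply: le_trans H _; rewrite /M; lra.
have M0 : 0 <= M by rewrite /M; lra.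
pose K : R := fine (((@lebesgue_measure R) \x (@lebesgue_measure R))%E D).
have K0 : 0 <= K by rewrite fine_ge0.
have [d d0 dMK] := small_step M0 K0 e0.
(* Order 1 controls [pullP] and [pullQ]: words of length at most 1 give the map and its first
   partials. *)
exists 1%N, d; split => // h Gh hg; have sh := G_o_symp2 Gh.
have [_ hD _ _ _] := sh.
have near p : D p -> [/\ `|(h p).1 - (g p).1| <= d, `|(h p).2 - (g p).2| <= d,
    `|dx (fun q => (h q).1) p - dx (fun q => (g q).1) p| <= d /\
    `|dy (fun q => (h q).1) p - dy (fun q => (g q).1) p| <= d &
    `|dx (fun q => (h q).2) p - dx (fun q => (g q).2) p| <= d /\
    `|dy (fun q => (h q).2) p - dy (fun q => (g q).2) p| <= d].
  move=> Dp; have [a1 a2] := hg [::] isT p Dp.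
  have [b1 b2] := hg [:: true] isT p Dp; have [e1 e2] := hg [:: false] isT p Dp.
  by split; [exact: ltW a1|exact: ltW a2|split; [exact: ltW b1|exact: ltW e1]|
    split; [exact: ltW b2|exact: ltW e2]].
have cP p : D p -> `|pullP h p - pullP g p| <= d * (1 + M).
  move=> Dp; have [n1 n2 [n3 n4] [n5 n6]] := near p Dp.
  have [h1 h2] := disk_coord_norm (hD _ Dp).
  rewrite /pullP /eta_a /eta_b.
  exact: (pull_near h2 (B1' _ Dp) (B3' _ Dp) (ltW d0) n1 n2 n3 n5 h1).
have cQ p : D p -> `|pullQ h p - pullQ g p| <= d * (1 + M).
  move=> Dp; have [n1 n2 [n3 n4] [n5 n6]] := near p Dp.
  have [h1 h2] := disk_coord_norm (hD _ Dp).
  rewrite /pullQ /eta_a /eta_b.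
  exact: (pull_near h2 (B2' _ Dp) (B4' _ Dp) (ltW d0) n1 n2 n4 n6 h1).
have cgh : contD (fun p => gen h p - gen g p).
  by move=> p Dp; apply: cvgB; [exact: (gen_contD sh Dp)|exact: (gen_contD sg Dp)].
have E1 := intDB (gen_contD sh) (gen_contD sg).
have E2 := intD_bound cgh (gen_near sg sh cP cQ).
have key (u x r : R) : u = x -> `|u| <= r -> r < e -> `|x| < e.
  by move=> -> /le_lt_trans; apply.
exact: key E1 E2 dMK.
Qed.

End Continuity.

(** * Twist maps and surjectivity *)

Section Twist.
Context {R : realType}.
Notation plane := (R * R)%type.
Notation D := (@disk R).
Notation pi := (@pi R).
Implicit Types (f : plane -> R) (p q : plane) (g h : plane -> plane) (t s c : R).

Definition twist c p : plane :=
  (p.1 * cos (c * nsq p) - p.2 * sin (c * nsq p),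
   p.1 * sin (c * nsq p) + p.2 * cos (c * nsq p)).

Lemma nsq_twist c p : nsq (twist c p) = nsq p.
Proof.
rewrite {1}/nsq /twist/=; have cs := cos2Dsin2 (c * nsq p).
transitivity ((p.1 ^+ 2 + p.2 ^+ 2) *
  (cos (c * nsq p) ^+ 2 + sin (c * nsq p) ^+ 2)); last by rewrite cs mulr1.
by move: (cos _) (sin _) => a b; ring.
Qed.

(** The angle depends on [nsq p], which a twist preserves, so the opposite angle undoes the
    rotation. *)
Lemma twistK c p : twist (- c) (twist c p) = p.
Proof.
rewrite {1}/twist nsq_twist mulNr cosN sinN /=; have cs := cos2Dsin2 (c * nsq p).
rewrite [RHS]surjective_pairing; move: (cos _) (sin _) cs => a b cs; congr pair.
- transitivity (p.1 * (a ^+ 2 + b ^+ 2)); [ring|by rewrite cs mulr1].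
- transitivity (p.2 * (a ^+ 2 + b ^+ 2)); [ring|by rewrite cs mulr1].
Qed.

Lemma disk_twist c p : D p -> D (twist c p).
Proof. by move=> Dp; have := nsq_twist c p; rewrite /disk/= /nsq => ->. Qed.

Lemma Ck_twist c k : Ck k setT (fun p => (twist c p).1) /\ Ck k setT (fun p => (twist c p).2).
Proof.
have oT := @openT plane; have cx := Ck_fst k oT; have cy := Ck_snd k oT.
have cn : Ck k setT (fun p : plane => c * nsq p).
  apply: Ck_Z => //; rewrite (_ : nsq = fun p : plane => p.1 * p.1 + p.2 * p.2).
    exact: Ck_D oT (Ck_M oT cx cx) (Ck_M oT cy cy).
  by apply/funext => p; rewrite /nsq !expr2.
have [cc cs] := Ck_cos_sin oT cn; split.
- exact: (Ck_D oT (Ck_M oT cx cc) (Ck_N oT (Ck_M oT cy cs))).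
- exact: (Ck_D oT (Ck_M oT cx cs) (Ck_M oT cy cc)).
Qed.

Lemma smooth_twist c : smooth_map_on_disk (twist c).
Proof.
exists setT; split => //; split; apply: Ck_smooth_on; try exact: openT;
  by move=> k; have [] := Ck_twist c k.
Qed.

Lemma PD_twist c p :
  let C := cos (c * nsq p) in let S := sin (c * nsq p) in
  PD (fun p => (twist c p).1) p (C - 2 * c * p.1 * (twist c p).2)
    (- S - 2 * c * p.2 * (twist c p).2) /\
  PD (fun p => (twist c p).2) p (S + 2 * c * p.1 * (twist c p).1)
    (C + 2 * c * p.2 * (twist c p).1).
Proof.
move=> C S; have n := PD_Z c (PD_nsq p).
have dc := PD_comp1 n (is_derive_cos (c * nsq p)).
have ds := PD_comp1 n (is_derive_sin (c * nsq p)).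
have x := PD_fst p; have y := PD_snd p; rewrite -/C -/S in dc ds.
split.
- apply: PD_eq (PD_D (PD_M x dc) (PD_N (PD_M y ds))) _ _;
  rewrite /twist/= -/C -/S; ring.
- apply: PD_eq (PD_D (PD_M x ds) (PD_M y dc)) _ _;
  rewrite /twist/= -/C -/S; ring.
Qed.

Lemma jac_twist c p : jac (twist c) p = 1.
Proof.
have [t1 t2] := PD_twist c p; rewrite /jac (PD_dx t1) (PD_dy t1) (PD_dx t2) (PD_dy t2).
rewrite /twist/=; have cs := cos2Dsin2 (c * nsq p).
move: (cos _) (sin _) cs => a b cs.
by transitivity (a ^+ 2 + b ^+ 2); [ring|rewrite cs].
Qed.

Lemma twist_G_o c : G_o (twist c).
Proof.
split; last by rewrite /twist /origin/= !mul0r subr0 addr0.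
split; [exact: smooth_twist|exact: disk_twist| |by move=> p _; exact: jac_twist].
exists (twist (- c)); split; [exact: smooth_twist|exact: disk_twist| |] => p _.
- exact: twistK.
- by have := twistK (- c) p; rewrite opprK.
Qed.

Lemma PD_nsq2 c p : PD (fun q => c / 4 * (nsq q * nsq q)) p
  (c * p.1 * nsq p) (c * p.2 * nsq p).
Proof. by apply: PD_eq (PD_Z (c / 4) (PD_M (PD_nsq p) (PD_nsq p))) _ _; field. Qed.

(** In polar coordinates eta = r^2 dtheta / 2, and the twist adds c r^2 to theta, so g^*eta - eta =
    c r^2 d(r^2) / 2 = d(c r^4 / 4). *)
Lemma gen_twist c p : D p -> gen (twist c) p = c / 4 * (nsq p * nsq p).
Proof.
move=> Dp; have [_ [_ _ G]] := gen_spec (G_o_symp2 (twist_G_o c)).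
apply: (@gen_unique _ _ (fun q => c / 4 * (nsq q * nsq q)) _ _ p Dp G); last first.
  by rewrite gen_origin /nsq /= expr0n/= addr0 !mulr0.
move=> q Dq; apply: PD_eq (PD_nsq2 c q) _ _.
- have [t1 t2] := PD_twist c q; rewrite /pullP (PD_dx t1) (PD_dx t2) /eta_a /eta_b /twist/=.
  have cs := cos2Dsin2 (c * nsq q); move: (cos _) (sin _) cs => a b cs.
  rewrite /nsq.
  transitivity (- q.2 / 2 * ((a ^+ 2 + b ^+ 2) - 1) + c * q.1 * (q.1 ^+ 2 + q.2 ^+ 2) * (a ^+ 2 + b ^+ 2)).
    by rewrite cs subrr mulr0 add0r mulr1.
  by field.
- have [t1 t2] := PD_twist c q; rewrite /pullQ (PD_dy t1) (PD_dy t2) /eta_a /eta_b /twist/=.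
  have cs := cos2Dsin2 (c * nsq q); move: (cos _) (sin _) cs => a b cs.
  rewrite /nsq.
  transitivity (q.1 / 2 * ((a ^+ 2 + b ^+ 2) - 1) + c * q.2 * (q.1 ^+ 2 + q.2 ^+ 2) * (a ^+ 2 + b ^+ 2)).
    by rewrite cs subrr mulr0 add0r mulr1.
  by field.
Qed.

Lemma intD_gen_twist c : intD (gen (twist c)) = c * (pi / 12).
Proof.
have oT := @openT plane; have DT : D `<=` setT by [].
have cx := Ck_fst 1 oT; have cy := Ck_snd 1 oT.
(* The form k r^4 (x dy - y dx) has curl 6 k r^4, which must be c r^4 / 4. On the circle it is k dt,
   with total 2 pi k = c pi / 12. *)
pose k := c / 24.
have PB p := PD_M (PD_fst p) (PD_nsq2 (4 * k) p).
have PA p := PD_N (PD_M (PD_snd p) (PD_nsq2 (4 * k) p)).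
have cn : Ck 1 setT (fun p : plane => nsq p).
  rewrite (_ : nsq = fun p : plane => p.1 * p.1 + p.2 * p.2).
    exact: Ck_D oT (Ck_M oT cx cx) (Ck_M oT cy cy).
  by apply/funext => p; rewrite /nsq !expr2.
have cq := Ck_Z (4 * k / 4) oT (Ck_M oT cn cn).
have cB := Ck_M oT cx cq; have cA := Ck_N oT (Ck_M oT cy cq).
have E t : is_derive t 1 (fun s => k * s)
    ((circ t).1 * (4 * k / 4 * (nsq (circ t) * nsq (circ t))) * cos t -
     (- ((circ t).2 * (4 * k / 4 * (nsq (circ t) * nsq (circ t))))) * sin t).
  apply: eq_is_derive (is_deriveZ k (is_derive_id t 1)) _.
  rewrite nsq_circ /circ/= /GRing.scale/=.
  transitivity (k * (cos t ^+ 2 + sin t ^+ 2)); first by rewrite cos2Dsin2.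
  by field.
have key := green oT DT cA cB E.
have e p : D p -> gen (twist c) p = dx (fun p => p.1 * (4 * k / 4 * (nsq p * nsq p))) p
    - dy (fun p => - (p.2 * (4 * k / 4 * (nsq p * nsq p)))) p.
  move=> Dp; rewrite (PD_dx (PB p)) (PD_dy (PA p)) (gen_twist c Dp) /k /nsq; by field.
apply: etrans (eq_intD e) _; apply: etrans key _; rewrite /k; by field.
Qed.

End Twist.

Unset Implicit Arguments.

Theorem theorem4p1 (R : realType) :
  let Phi := fun g : R * R -> R * R => tau_bar g - pi * sigma_bar g in
  [/\ (forall g h : R * R -> R * R, G_o g -> G_o h ->
         Phi (g \o h) = Phi g + Phi h),
      (forall r : R, exists g : R * R -> R * R, G_o g /\ Phi g = r) &
      Cinf_continuous_on_G_o Phi].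
Proof.
move=> Phi; have PhiE g : symp2 g -> Phi g = - intD (gen g).
  exact: tau_bar_sigma_bar.
split.
- move=> g h /G_o_symp2 sg /G_o_symp2 sh.
  have key (u v w x y z : R) :
      u = - x -> v = - y -> w = - z -> x = y + z -> u = v + w.
    by move=> -> -> -> ->; rewrite opprD.
  exact: key (PhiE _ (symp2_comp sg sh)) (PhiE _ sg) (PhiE _ sh)
    (intD_gen_comp sg sh).
- move=> r; have pi_neq0 : pi != 0 :> R by rewrite gt_eqF// pi_gt0.
  (* [Phi (twist c)] is - c pi / 12, and [c] is solved for so that this equals [r]. *)
  exists (twist (- (12 * r / pi))).
  split; first exact: twist_G_o.
  have key (u x y : R) : u = - x -> x = y -> u = - y by move=> -> ->.
  rewrite (key _ _ _ (PhiE _ (G_o_symp2 (twist_G_o _))) (intD_gen_twist _)).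
  by move: (pi : R) pi_neq0 => x x0; field.
- move=> g Gg e e0; have [k [d [d0 H]]] := intD_gen_continuous Gg e0.
  exists k, d; split => // h Gh hg.
  have key (u v x y : R) : u = - x -> v = - y -> `|x - y| < e -> `|u - v| < e.
    by move=> -> ->; rewrite -opprD normrN.
  exact: key (PhiE _ (G_o_symp2 Gh)) (PhiE _ (G_o_symp2 Gg)) (H h Gh hg).
Qed.
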